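(* Let $\xi\ge2$ be a countable ordinal, let $(X,\tau)$ be an uncountable Polish space and let $\zeta$ be a nonzero countable ordinal. Then there exist $f,g\in\mathfrak B_\xi(X,\tau)$ such that $\beta^*_\xi(f)\le\omega^\zeta$, $\beta^*_\xi(g)\le\omega^\zeta$ and $\beta^*_\xi(fg)>\omega^\zeta$. In particular $\beta^*_\xi$ is not essentially multiplicative.
   Context: Baire classes $\mathfrak B_\xi(X,\tau)$: $\mathfrak B_0$ = continuous real functions; $\mathfrak B_\xi$ = pointwise limits of sequences in $\bigcup_{\zeta<\xi}\mathfrak B_\zeta$. Borel classes: $\Sigma^0_1(\tau)=\tau$, $\Pi^0_\xi(\tau)=\{F:F^c\in\Sigma^0_\xi(\tau)\}$, $\Sigma^0_\xi(\tau)=\{\bigcup_nA_n:A_n\in\Pi^0_{\xi_n}(\tau),\xi_n<\xi\}$ for $\xi>1$. For a Polish topology $\tau'$ on $X$, $\beta_{\tau'}$ is the oscillation rank in $(X,\tau')$: for $f:X\to\mathbb R$, $\varepsilon>0$ and closed $F$, $D^0_{\tau'}(f,\varepsilon,F)=F$, $D^1_{\tau'}(f,\varepsilon,F)$ = set of $x\in F$ such that every $\tau'$-neighbourhood $U$ of $x$ contains $x_1,x_2\in F\cap U$ with $|f(x_1)-f(x_2)|\ge\varepsilon$, iterated transfinitely (intersections at limits); $\beta_{\tau'}(f,\varepsilon)$ = least $\alpha$ with $D^\alpha_{\tau'}(f,\varepsilon,X)=\emptyset$ ($\omega_1$ if none), $\beta_{\tau'}(f)=\sup_{\varepsilon>0}\beta_{\tau'}(f,\varepsilon)$.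 For $f\in\mathfrak B_\xi(X,\tau)$, $T_{f,\xi}$ is the (nonempty) set of Polish topologies $\tau'$ with $\tau\subseteq\tau'\subseteq\Sigma^0_\xi(\tau)$ and $f\in\mathfrak B_1(X,\tau')$, and $\beta^*_\xi(f)=\min_{\tau'\in T_{f,\xi}}\beta_{\tau'}(f)$. *)

(* Defs.v *)
From Stdlib Require Import Reals.
Open Scope R_scope.

(** * Countable ordinals as Brouwer trees *)
Inductive ord : Type :=
| OZ : ord
| OS : ord -> ord
| OL : (nat -> ord) -> ord.  (* supremum of a sequence *)

(* The (semantic) order on Brouwer trees: [ole a b] iff |a| <= |b|. *)
Fixpoint ole (a : ord) : ord -> Prop :=
  match a with
  | OZ => fun _ => True
  | OL f => fun b => forall n, ole (f n) b
  | OS a' => fix aux (b : ord) : Prop :=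
      match b with
      | OZ => False
      | OS b' => ole a' b'
      | OL g => exists n, aux (g n)
      end
  end.

Definition olt (a b : ord) : Prop := ole (OS a) b.
Definition oeq (a b : ord) : Prop := ole a b /\ ole b a.

Definition o1 : ord := OS OZ.
Definition o2 : ord := OS (OS OZ).

Fixpoint oadd (a b : ord) : ord :=
  match b with
  | OZ => a
  | OS b' => OS (oadd a b')
  | OL g => OL (fun n => oadd a (g n))
  end.

Fixpoint omul_nat (a : ord) (n : nat) : ord :=
  match n with
  | O => OZ
  | S n' => oadd (omul_nat a n') a
  end.

Fixpoint oexp_omega (z : ord) : ord :=
  match z with
  | OZ => o1
  | OS z' => OL (fun n => omul_nat (oexp_omega z') n)
  | OL g => OL (fun n => oexp_omega (g n))
  end.

Section Topo.
Context {X : Type}.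

Definition is_metric (d : X -> X -> R) : Prop :=
  (forall x y, 0 <= d x y) /\
  (forall x y, d x y = 0 <-> x = y) /\
  (forall x y, d x y = d y x) /\
  (forall x y z, d x z <= d x y + d y z).

Definition metric_complete (d : X -> X -> R) : Prop :=
  forall u : nat -> X,
    (forall eps, eps > 0 -> exists N, forall m n, (N <= m)%nat -> (N <= n)%nat ->
        d (u m) (u n) < eps) ->
    exists l, forall eps, eps > 0 -> exists N, forall n, (N <= n)%nat -> d (u n) l < eps.

Definition metric_open (d : X -> X -> R) (U : X -> Prop) : Prop :=
  forall x, U x -> exists r, r > 0 /\ forall y, d x y < r -> U y.

Definition metric_separable (d : X -> X -> R) : Prop :=
  exists s : nat -> X, forall x r, r > 0 -> exists n, d x (s n) < r.

Definition Polish (tau : (X -> Prop) -> Prop) : Prop :=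
  exists d : X -> X -> R,
    is_metric d /\ metric_complete d /\ metric_separable d /\
    (forall U, tau U <-> metric_open d U).

Definition uncountable_type : Prop :=
  forall f : nat -> X, exists x, forall n, f n <> x.

Inductive Sigma0 (tau : (X -> Prop) -> Prop) : ord -> (X -> Prop) -> Prop :=
| Sigma0_open : forall xi A, oeq xi o1 -> tau A -> Sigma0 tau xi A
| Sigma0_union : forall xi (A : X -> Prop) (B : nat -> X -> Prop),
    ole o2 xi ->
    (forall n, exists z, ole o1 z /\ olt z xi /\ Sigma0 tau z (fun x => ~ B n x)) ->
    (forall x, A x <-> exists n, B n x) ->
    Sigma0 tau xi A.

Definition Pi0 (tau : (X -> Prop) -> Prop) (xi : ord) (F : X -> Prop) : Prop :=
  Sigma0 tau xi (fun x => ~ F x).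

Definition R_open (V : R -> Prop) : Prop :=
  forall y, V y -> exists r, r > 0 /\ forall z, Rabs (z - y) < r -> V z.

Definition continuous_tau (tau : (X -> Prop) -> Prop) (f : X -> R) : Prop :=
  forall V, R_open V -> tau (fun x => V (f x)).

Inductive Baire (tau : (X -> Prop) -> Prop) : ord -> (X -> R) -> Prop :=
| Baire_cont : forall xi f, continuous_tau tau f -> Baire tau xi f
| Baire_lim : forall xi (fs : nat -> X -> R) f,
    (forall n, exists z, olt z xi /\ Baire tau z (fs n)) ->
    (forall x, Un_cv (fun n => fs n x) (f x)) ->
    Baire tau xi f.

Definition D1 (tau' : (X -> Prop) -> Prop) (f : X -> R) (eps : R) (F : X -> Prop)
  : X -> Prop :=
  fun x => F x /\ forall U, tau' U -> U x ->
     exists x1 x2, F x1 /\ U x1 /\ F x2 /\ U x2 /\ Rabs (f x1 - f x2) >= eps.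

Fixpoint Dalpha (tau' : (X -> Prop) -> Prop) (f : X -> R) (eps : R) (a : ord)
  : X -> Prop :=
  match a with
  | OZ => fun _ => True
  | OS a' => D1 tau' f eps (Dalpha tau' f eps a')
  | OL g => fun x => forall n, Dalpha tau' f eps (g n) x
  end.

(* beta_{tau'}(f, eps) <= a : the least ordinal with empty derived set is <= a *)
Definition beta_eps_le (tau' : (X -> Prop) -> Prop) (f : X -> R) (eps : R) (a : ord)
  : Prop :=
  exists g, ole g a /\ forall x, ~ Dalpha tau' f eps g x.

(* beta_{tau'}(f) = sup_{eps>0} beta_{tau'}(f,eps) <= a *)
Definition beta_le (tau' : (X -> Prop) -> Prop) (f : X -> R) (a : ord) : Prop :=
  forall eps, eps > 0 -> beta_eps_le tau' f eps a.

Definition T_f (tau : (X -> Prop) -> Prop) (xi : ord) (f : X -> R)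
  (tau' : (X -> Prop) -> Prop) : Prop :=
  Polish tau' /\
  (forall U, tau U -> tau' U) /\
  (forall U, tau' U -> Sigma0 tau xi U) /\
  Baire tau' o1 f.

(* beta*_xi(f) = min_{tau' in T_{f,xi}} beta_{tau'}(f) <= a *)
Definition beta_star_le (tau : (X -> Prop) -> Prop) (xi : ord) (f : X -> R) (a : ord)
  : Prop :=
  exists tau', T_f tau xi f tau' /\ beta_le tau' f a.

End Topo.

(* Main.v *)
Require Import Defs.
From Stdlib Require Import Reals Lra Lia Arith Cantor.
From Stdlib Require Import Classical ClassicalEpsilon.
From Stdlib Require Import FunctionalExtensionality PropExtensionality.
Open Scope R_scope.

(* The topologies in [T_f] have their open sets in Sigma^0_xi, so closed sets of such a
   topology are Pi^0_xi. Hence, if [indic A] has rank at most L = omega^zeta for one of them,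
   both A and its complement are given by a decision list of Sigma^0_xi conditions ordered
   in type L: at x, the first alpha with x outside D^(alpha+1) determines A near x on D^alpha.
   Since L is a limit of ordinals [h n], the space is moreover covered by the Sigma^0_xi sets
   on which a list of length [h n] suffices. Reading codes of such covers and lists off the
   point x itself (an uncountable Polish space carries an independent sequence of open sets)
   gives, by diagonalization, a set A for which no such representation of the complement
   exists, so that beta*_xi of its indicator exceeds L.

   This indicator is f g for f and g of small rank. Writing the cover as countably many
   Pi^0_(<xi) sets [B k], let f be k + 1 where k is the first index with x in [B k]
   (and 0 if there is none), and let g be 1 / (k + 1) times the indicator of A. Refine the
   topology so that all the coded Pi^0_(<xi) sets are clopen. Then f is locally constant off
   the closed set f = 0, so its rank is at most 2. Each set f = k + 1 is clopen and g has
   rank below L on it, while the oscillation of g tends to 0 towards the set f = 0. *)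

(** * Ordinals *)

(** The codes describe sets of class below xi rather than Sigma^0_xi conditions because f and g need
    a topology whose open sets are all Sigma^0_xi: sets of class below xi can be made clopen in it,
    an arbitrary Sigma^0_xi set cannot. Each Sigma^0_xi condition is therefore split into countably
    many pieces of lower class, entered separately in the list with the same rank.

    A code is arbitrary, so the list it describes may contradict itself. Ordering the entries by
    rank and then by index makes every code define a set, and this one rule serves both bounds: an
    entry that wins at x in the list of a genuine set of small rank is right about x, and on D^alpha
    of g only entries of rank at least alpha can hold, so that just finitely many competitors have
    to be excluded near a point.

    The indicator of A has rank below L on each clopen set f = k + 1 of the refined topology, but
    these sets may accumulate at f = 0. The weight 1 / (k + 1) removes the oscillation there, and
    multiplying by the unbounded f restores it. The diagonal point is one where the list that it
    codes for the complement of A coincides with the list that defines A. *)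

Lemma ole_OL_r (a : ord) (f : nat -> ord) (n : nat) : ole a (f n) -> ole a (OL f).
Proof.
  induction a as [|a IH|g IH]; simpl; auto.
  intros H; exists n; exact H.
Qed.

Lemma ole_refl (a : ord) : ole a a.
Proof.
  induction a as [|a IH|f IH]; simpl; auto.
  intros n; apply ole_OL_r with n; auto.
Qed.

Lemma ole_trans (a b c : ord) : ole a b -> ole b c -> ole a c.
Proof.
  revert b c; induction a as [|a IHa|f IHa]; intros b c.
  - simpl; auto.
  - revert c; induction b as [|b IHb|g IHb]; intros c Hab Hbc.
    + destruct Hab.
    + induction c as [|c IHc|h IHc].
      * destruct Hbc.
      * apply (IHa b c Hab Hbc).
      * destruct Hbc as [n Hn]; exists n; apply IHc; exact Hn.
    + destruct Hab as [n Hn]; apply (IHb n); auto.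
  - intros Hab Hbc n; apply (IHa n b c); auto.
Qed.

Lemma ole_S_r (a b : ord) : ole a b -> ole a (OS b).
Proof.
  revert b; induction a as [|a IHa|f IHa]; intros b Hab.
  - exact I.
  - change (ole a b).
    induction b as [|b IHb|g IHb].
    + destruct Hab.
    + apply IHa; exact Hab.
    + destruct Hab as [n Hn]; apply ole_OL_r with n; apply IHb; exact Hn.
  - intros n; apply IHa; apply Hab.
Qed.

Lemma ole_S (a : ord) : ole a (OS a).
Proof. apply ole_S_r, ole_refl. Qed.

Lemma olt_ole (a b : ord) : olt a b -> ole a b.
Proof. intros H; apply ole_trans with (OS a); [apply ole_S | exact H]. Qed.

Lemma ole_or_olt (a b : ord) : ole a b \/ olt b a.
Proof.
  unfold olt; revert b; induction a as [|a IHa|f IHa]; intros b.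
  - left; exact I.
  - induction b as [|b IHb|g IHb].
    + right; exact I.
    + apply (IHa b).
    + destruct (classic (exists n, ole (OS a) (g n))) as [H|H].
      * left; exact H.
      * right; intros n.
        destruct (IHb n) as [H1|H1]; [|exact H1].
        exfalso; apply H; exists n; exact H1.
  - destruct (classic (forall n, ole (f n) b)) as [H|H].
    + left; exact H.
    + right; apply not_all_ex_not in H as [n Hn].
      destruct (IHa n b) as [H1|H1]; [contradiction|].
      apply ole_OL_r with n; exact H1.
Qed.

Lemma ole_total (a b : ord) : ole a b \/ ole b a.
Proof. destruct (ole_or_olt a b); [left | right; apply olt_ole]; auto. Qed.

Lemma olt_wf : well_founded olt.
Proof.
  assert (H : forall a b, ole b a -> Acc olt b).
  { intros a; induction a as [|a IH|f IH]; intros b Hb; constructor; intros c Hc;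
      assert (Hca := ole_trans _ _ _ Hc Hb).
    - destruct Hca.
    - apply IH; exact Hca.
    - destruct Hca as [n Hn]; apply (IH n); apply olt_ole; exact Hn. }
  intros a; apply (H a); apply ole_refl.
Qed.

Lemma olt_irrefl (a : ord) : ~ olt a a.
Proof. induction (olt_wf a) as [a _ IH]; intros H; exact (IH a H H). Qed.

Lemma oeq_refl (a : ord) : oeq a a.
Proof. split; apply ole_refl. Qed.

Lemma oeq_o1_or_o2_le (a : ord) : ole o1 a -> oeq a o1 \/ ole o2 a.
Proof.
  intros H; destruct (ole_or_olt a o1) as [H1|H1]; [left; split | right]; auto.
Qed.

(** The tree itself lists the ordinals below it: under a supremum lies either the supremum or
    something under one of its terms. This is what lets ranks and Borel classes be indexed by
    natural numbers. *)
Lemma ole_enum (a : ord) :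
  exists e : nat -> ord, (forall i, ole (e i) a) /\
    forall b, ole b a -> exists i, oeq b (e i).
Proof.
  induction a as [|a [e [He1 He2]]|f IH].
  - exists (fun _ => OZ); split; [intros; exact I|].
    intros b Hb; exists 0%nat; split; auto; exact I.
  - exists (fun i => match i with O => OS a | S i => e i end); split.
    + intros [|i]; [apply ole_refl | apply ole_S_r; auto].
    + intros b Hb; destruct (ole_or_olt (OS a) b) as [H|H].
      * exists 0%nat; split; auto.
      * destruct (He2 b H) as [i Hi]; exists (S i); exact Hi.
  - apply choice in IH as [e He].
    exists (fun i => match i with
                     | O => OL f
                     | S i => let (n, m) := Cantor.of_nat i in e n m
                     end); split.
    + intros [|i]; [apply ole_refl|].
      destruct (Cantor.of_nat i) as [n m].
      apply ole_OL_r with n; apply (He n).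
    + intros b Hb; destruct (ole_or_olt (OL f) b) as [H|H].
      * exists 0%nat; split; auto.
      * destruct H as [n Hn]; apply olt_ole in Hn.
        destruct (He n) as [_ H2]; destruct (H2 b Hn) as [m Hm].
        exists (S (Cantor.to_nat (n, m))); rewrite Cantor.cancel_of_to; exact Hm.
Qed.

Lemma olt_enum (xi : ord) : ole o2 xi ->
  exists e : nat -> ord, (forall i, ole o1 (e i) /\ olt (e i) xi) /\
    forall b, ole o1 b -> olt b xi -> exists i, oeq b (e i).
Proof.
  intros Hxi; destruct (ole_enum xi) as [e [He1 He2]].
  (* Indices outside the interval [1, xi) are sent to [o1], which belongs to it because xi is at
     least 2; every index thus denotes a legitimate class. *)
  exists (fun i => if excluded_middle_informative (ole o1 (e i) /\ olt (e i) xi)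
                   then e i else o1); split.
  - intros i; destruct excluded_middle_informative as [H|H]; [exact H|].
    split; [apply ole_refl | exact Hxi].
  - intros b Hb1 Hb2; destruct (He2 b (olt_ole _ _ Hb2)) as [i [Hi1 Hi2]].
    exists i; destruct excluded_middle_informative as [H|H]; [split; auto|].
    exfalso; apply H; split.
    + apply ole_trans with b; auto.
    + apply ole_trans with (OS b); auto.
Qed.

Lemma omax_lt (a b c : ord) : olt a c -> olt b c ->
  exists m, ole a m /\ ole b m /\ olt m c.
Proof.
  intros Ha Hb; destruct (ole_total a b); [exists b | exists a]; auto using ole_refl.
Qed.

Lemma ole_oadd_l (a b : ord) : ole a (oadd a b).
Proof.
  induction b as [|b IH|g IH]; simpl.
  - apply ole_refl.
  - apply ole_S_r; exact IH.
  - apply ole_OL_r with 0%nat; apply IH.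
Qed.

Lemma olt_oadd_l (a b : ord) : ole o1 b -> olt a (oadd a b).
Proof.
  unfold olt; induction b as [|b IH|g IH]; intros H.
  - destruct H.
  - change (ole a (oadd a b)); apply ole_oadd_l.
  - destruct H as [n Hn]; exists n; apply IH; exact Hn.
Qed.

Lemma oexp_omega_ge1 (z : ord) : ole o1 (oexp_omega z).
Proof.
  induction z as [|z IH|g IH].
  - apply ole_refl.
  - exists 1%nat; apply (olt_oadd_l OZ); exact IH.
  - exists 0%nat; apply IH.
Qed.

Lemma ole_oexp_omega_o1 (z : ord) : ole z OZ -> ole (oexp_omega z) o1.
Proof.
  induction z as [|z IH|g IH]; intros H.
  - apply ole_refl.
  - destruct H.
  - intros n; apply IH; apply H.
Qed.

(** For a successor exponent the finite multiples of the previous power are cofinal; for a supremum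
    the sequences of the terms are merged into one. *)
Lemma oexp_omega_cofinal (z : ord) : ole o1 z ->
  exists h : nat -> ord, ole (oexp_omega z) (OL h) /\
    forall n, olt (h n) (oexp_omega z).
Proof.
  assert (Hsucc : forall y n, olt (omul_nat (oexp_omega y) n) (oexp_omega (OS y))).
  { intros y n; exists (S n); apply olt_oadd_l, oexp_omega_ge1. }
  induction z as [|z _|g IH]; intros H.
  - destruct H.
  - exists (fun n => omul_nat (oexp_omega z) n); split; [apply ole_refl | apply Hsucc].
  - assert (H' : forall n, exists h : nat -> ord,
               (ole o1 (g n) -> ole (oexp_omega (g n)) (OL h)) /\
               forall m, olt (h m) (oexp_omega (OL g))).
    { intros n; destruct (classic (ole o1 (g n))) as [Hn|Hn].
      - destruct (IH n Hn) as [h [H1 H2]]; exists h; split; auto.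
        intros m; exists n; apply H2.
      - exists (fun _ => OZ); split; [tauto|].
        intros _; apply (oexp_omega_ge1 (OL g)). }
    apply choice in H' as [h Hh].
    assert (Hle : forall n, ole o1 (g n) -> ole (oexp_omega (g n))
              (OL (fun i => let (n, m) := Cantor.of_nat i in h n m))).
    { intros n Hn; apply ole_trans with (OL (h n)); [apply Hh; exact Hn|].
      intros m; apply ole_OL_r with (Cantor.to_nat (n, m)).
      rewrite Cantor.cancel_of_to; apply ole_refl. }
    exists (fun i => let (n, m) := Cantor.of_nat i in h n m); split.
    + intros n; destruct (ole_or_olt (g n) OZ) as [Hn|Hn]; [|apply Hle; exact Hn].
      apply ole_trans with o1; [apply ole_oexp_omega_o1; exact Hn|].
      destruct H as [k Hk]; apply ole_trans with (oexp_omega (g k));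
        [apply oexp_omega_ge1 | apply Hle; exact Hk].
    + intros i; destruct (Cantor.of_nat i) as [n m]; apply Hh.
Qed.

(** * Borel classes *)

Lemma set_ext {X : Type} (A B : X -> Prop) : (forall x, A x <-> B x) -> A = B.
Proof.
  intros H; apply functional_extensionality; intros x.
  apply propositional_extensionality; apply H.
Qed.

Lemma not_not_set {X : Type} (A : X -> Prop) : (fun x => ~ ~ A x) = A.
Proof. apply set_ext; intros x; split; [apply NNPP | tauto]. Qed.

Lemma inv_INR_small (r : R) : r > 0 -> exists n : nat, / INR (S n) < r.
Proof.
  intros H; destruct (archimed_cor1 r H) as [[|n] [H1 H2]]; [lia|].
  exists n; exact H1.
Qed.

Lemma inv_INR_pos (n : nat) : 0 < / INR (S n).
Proof. apply Rinv_0_lt_compat, lt_0_INR; lia. Qed.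

Lemma inv_INR_anti (m n : nat) : (m <= n)%nat -> / INR (S n) <= / INR (S m).
Proof. intros H; apply Rinv_le_contravar; [apply lt_0_INR; lia | apply le_INR; lia]. Qed.

Section Borel.
Context {X : Type} (d : X -> X -> R) (tau : (X -> Prop) -> Prop).
Context (Hd : is_metric d) (Htau : forall U, tau U <-> metric_open d U).

Lemma metric_open_ball (x : X) (r : R) : metric_open d (fun y => d x y < r).
Proof.
  destruct Hd as [_ [_ [_ tri]]].
  intros y Hy; exists (r - d x y); split; [lra|].
  intros z Hz; specialize (tri x y z); lra.
Qed.

Lemma metric_open_bigcup (I : Type) (A : I -> X -> Prop) :
  (forall i, metric_open d (A i)) -> metric_open d (fun x => exists i, A i x).
Proof.
  intros H x [i Hi]; destruct (H i x Hi) as [r [Hr1 Hr2]].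
  exists r; split; auto; intros y Hy; exists i; auto.
Qed.

Lemma metric_open_setI (A B : X -> Prop) :
  metric_open d A -> metric_open d B -> metric_open d (fun x => A x /\ B x).
Proof.
  intros HA HB x [Ax Bx].
  destruct (HA x Ax) as [r [Hr1 Hr2]]; destruct (HB x Bx) as [s [Hs1 Hs2]].
  exists (Rmin r s); split; [apply Rmin_pos; auto|].
  intros y Hy; split; [apply Hr2 | apply Hs2].
  - apply Rlt_le_trans with (1 := Hy); apply Rmin_l.
  - apply Rlt_le_trans with (1 := Hy); apply Rmin_r.
Qed.

(* A substitute for the distance to the complement of [U], defined also for [U] = [X]. *)
Lemma open_lipschitz_witness (U : X -> Prop) : metric_open d U ->
  exists h : X -> R, (forall x, 0 <= h x <= 1) /\
    (forall x y, h x <= h y + d x y) /\ (forall x, U x <-> h x > 0).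
Proof.
  destruct Hd as [pos [d0 [sym tri]]].
  intros HU.
  set (E := fun x r => 0 <= r <= 1 /\ forall y, d x y < r -> U y).
  assert (HE0 : forall x, E x 0).
  { intros x; split; [lra|]; intros y Hy; specialize (pos x y); lra. }
  assert (HL : forall x, exists m, is_lub (E x) m).
  { intros x; destruct (completeness (E x)) as [m Hm].
    - exists 1; intros r [Hr _]; lra.
    - exists 0; apply HE0.
    - exists m; exact Hm. }
  apply choice in HL as [h Hh].
  assert (Hh0 : forall x, 0 <= h x) by (intros x; apply (Hh x); apply HE0).
  exists h; repeat split; auto.
  - apply (Hh x); intros r [Hr _]; lra.
  - intros x y; apply (Hh x); intros r [Hr1 Hr2].
    destruct (Rle_dec r (d x y)) as [H|H]; [specialize (Hh0 y); lra|].
    enough (r - d x y <= h y) by lra.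
    apply (Hh y); split.
    + specialize (pos x y); lra.
    + intros z Hz; apply Hr2; specialize (tri x y z); lra.
  - intros Ux; destruct (HU x Ux) as [r [Hr1 Hr2]].
    apply Rlt_le_trans with (Rmin r 1); [apply Rmin_pos; lra|].
    apply (Hh x); split; [split; [apply Rmin_glb; lra | apply Rmin_r]|].
    intros y Hy; apply Hr2; apply Rlt_le_trans with (1 := Hy); apply Rmin_l.
  - intros H; apply NNPP; intros HUx.
    enough (h x <= 0) by lra.
    apply (Hh x); intros r [Hr1 Hr2]; apply Rnot_lt_le; intros Hr.
    apply HUx, Hr2; rewrite (proj2 (d0 x x) eq_refl); exact Hr.
Qed.

(** The closed sets h >= 1/(n+1) exhaust U. Monotonicity of the hierarchy rests on this at its first
    step, because from class 2 on sets are built only from complements of lower classes. *)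
Lemma open_Fsigma (U : X -> Prop) : metric_open d U ->
  exists F : nat -> X -> Prop, (forall n, metric_open d (fun x => ~ F n x)) /\
    forall x, U x <-> exists n, F n x.
Proof.
  intros HU; destruct (open_lipschitz_witness U HU) as [h [h01 [hlip hU]]].
  destruct Hd as [_ [_ [sym _]]].
  exists (fun n x => / INR (S n) <= h x); split.
  - intros n x Hx; apply Rnot_le_lt in Hx.
    exists (/ INR (S n) - h x); split; [lra|].
    intros y Hy; specialize (hlip y x); rewrite sym in hlip; lra.
  - intros x; rewrite hU; split.
    + intros Hx; destruct (inv_INR_small (h x) Hx) as [n Hn]; exists n; lra.
    + intros [n Hn]; assert (H := inv_INR_pos n); lra.
Qed.

Lemma Sigma0_union_inv (xi : ord) (A : X -> Prop) : ole o2 xi -> Sigma0 tau xi A ->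
  exists B : nat -> X -> Prop,
    (forall n, exists z, ole o1 z /\ olt z xi /\ Pi0 tau z (B n)) /\
    (forall x, A x <-> exists n, B n x).
Proof.
  intros Hxi HA; destruct HA as [xi A [H _] _ | xi A B _ HB HAB].
  - exfalso; apply (olt_irrefl o1); apply ole_trans with xi; auto.
  - exists B; auto.
Qed.

Lemma Sigma0_o1_inv (xi : ord) (A : X -> Prop) : oeq xi o1 -> Sigma0 tau xi A -> tau A.
Proof.
  intros [H1 _] HA; destruct HA as [xi A _ HA | xi A B Hxi _ _]; auto.
  exfalso; apply (olt_irrefl o1); apply ole_trans with xi; auto.
Qed.

Lemma Sigma0_le (a b : ord) (A : X -> Prop) :
  ole o1 a -> ole a b -> Sigma0 tau a A -> Sigma0 tau b A.
Proof.
  intros Ha Hab HA; destruct (oeq_o1_or_o2_le a Ha) as [H1|H2].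
  - assert (HA' := Sigma0_o1_inv _ _ H1 HA).
    destruct (oeq_o1_or_o2_le b (ole_trans _ _ _ Ha Hab)) as [Hb|Hb].
    + apply Sigma0_open; auto.
    + destruct (open_Fsigma A) as [F [HF HAF]]; [apply Htau; exact HA'|].
      apply Sigma0_union with F; auto.
      intros n; exists o1; repeat split; auto using ole_refl.
      apply Sigma0_open; [apply oeq_refl | apply Htau; auto].
  - destruct (Sigma0_union_inv _ _ H2 HA) as [B [HB HAB]].
    apply Sigma0_union with B; auto.
    + apply ole_trans with a; auto.
    + intros n; destruct (HB n) as [z [Hz1 [Hz2 Hz3]]].
      exists z; repeat split; auto; apply ole_trans with a; auto.
Qed.

Lemma Pi0_Sigma0 (z xi : ord) (A : X -> Prop) :
  ole o1 z -> olt z xi -> Pi0 tau z A -> Sigma0 tau xi A.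
Proof.
  intros Hz Hlt HA; apply Sigma0_union with (fun _ => A).
  - apply ole_trans with (OS z); auto.
  - intros _; exists z; auto.
  - intros x; split; [intros H; exists 0%nat; auto | intros [_ H]; auto].
Qed.

Lemma Sigma0_bigcup (xi : ord) (A : nat -> X -> Prop) : ole o1 xi ->
  (forall n, Sigma0 tau xi (A n)) -> Sigma0 tau xi (fun x => exists n, A n x).
Proof.
  intros Hxi HA; destruct (oeq_o1_or_o2_le xi Hxi) as [H1|H2].
  - apply Sigma0_open; auto; apply Htau, metric_open_bigcup.
    intros n; apply Htau; apply (Sigma0_o1_inv xi); auto.
  - assert (HB := fun n => Sigma0_union_inv _ _ H2 (HA n)).
    apply choice in HB as [B HB].
    apply Sigma0_union with (fun i => let (n, m) := Cantor.of_nat i in B n m); auto.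
    + intros i; destruct (Cantor.of_nat i) as [n m]; apply (HB n).
    + intros x; split.
      * intros [n Hn]; apply (HB n) in Hn as [m Hm].
        exists (Cantor.to_nat (n, m)); rewrite Cantor.cancel_of_to; exact Hm.
      * intros [i Hi]; destruct (Cantor.of_nat i) as [n m].
        exists n; apply (HB n); exists m; exact Hi.
Qed.

Lemma Sigma0_setU (xi : ord) (A B : X -> Prop) : ole o1 xi ->
  Sigma0 tau xi A -> Sigma0 tau xi B -> Sigma0 tau xi (fun x => A x \/ B x).
Proof.
  intros Hxi HA HB.
  replace (fun x => A x \/ B x)
    with (fun x => exists n, (match n with O => A | _ => B end) x).
  - apply Sigma0_bigcup; auto; intros [|n]; auto.
  - apply set_ext; intros x; split.
    + intros [[|n] Hn]; auto.
    + intros [H|H]; [exists 0%nat | exists 1%nat]; auto.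
Qed.

(** No induction is involved: the complement of an intersection of two pieces is a union, which
    [Sigma0_setU] handles once both are raised to a common class below xi. *)
Lemma Sigma0_setI (xi : ord) (A B : X -> Prop) : ole o1 xi ->
  Sigma0 tau xi A -> Sigma0 tau xi B -> Sigma0 tau xi (fun x => A x /\ B x).
Proof.
  intros Hxi HA HB; destruct (oeq_o1_or_o2_le xi Hxi) as [H1|H2].
  - apply Sigma0_open; auto; apply Htau, metric_open_setI;
      apply Htau; apply (Sigma0_o1_inv xi); auto.
  - destruct (Sigma0_union_inv _ _ H2 HA) as [A' [HA' HAA]].
    destruct (Sigma0_union_inv _ _ H2 HB) as [B' [HB' HBB]].
    apply Sigma0_union with
      (fun i x => let (n, m) := Cantor.of_nat i in A' n x /\ B' m x); auto.
    + intros i; destruct (Cantor.of_nat i) as [n m].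
      destruct (HA' n) as [a [Ha1 [Ha2 Ha3]]]; destruct (HB' m) as [b [Hb1 [Hb2 Hb3]]].
      destruct (omax_lt a b xi Ha2 Hb2) as [c [Hac [Hbc Hc]]].
      assert (Hc1 : ole o1 c) by (apply ole_trans with a; auto).
      exists c; repeat split; auto.
      replace (fun x => ~ (A' n x /\ B' m x)) with (fun x => ~ A' n x \/ ~ B' m x).
      * apply Sigma0_setU; auto; [apply Sigma0_le with a | apply Sigma0_le with b]; auto.
      * apply set_ext; intros x; tauto.
    + intros x; split.
      * intros [Hx1 Hx2]; apply HAA in Hx1 as [n Hn]; apply HBB in Hx2 as [m Hm].
        exists (Cantor.to_nat (n, m)); rewrite Cantor.cancel_of_to; auto.
      * intros [i Hi]; destruct (Cantor.of_nat i) as [n m]; destruct Hi as [Hn Hm].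
        split; [apply HAA; exists n | apply HBB; exists m]; auto.
Qed.

Lemma Sigma0_metric_open (xi : ord) (A : X -> Prop) : ole o1 xi ->
  metric_open d A -> Sigma0 tau xi A.
Proof.
  intros Hxi HA; apply Sigma0_le with o1; auto using ole_refl.
  apply Sigma0_open; [apply oeq_refl | apply Htau; exact HA].
Qed.

Lemma Sigma0_const (xi : ord) (P : Prop) : ole o1 xi -> Sigma0 tau xi (fun _ => P).
Proof.
  intros Hxi; apply Sigma0_metric_open; auto.
  intros x HP; exists 1; split; [lra | auto].
Qed.

Lemma Sigma0_bigcap_lt (xi : ord) (A : nat -> X -> Prop) (N : nat) : ole o1 xi ->
  (forall n, (n < N)%nat -> Sigma0 tau xi (A n)) ->
  Sigma0 tau xi (fun x => forall n, (n < N)%nat -> A n x).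
Proof.
  intros Hxi; induction N as [|N IH]; intros HA.
  - replace (fun x => forall n, (n < 0)%nat -> A n x) with (fun _ : X => True).
    + apply Sigma0_const; auto.
    + apply set_ext; intros x; split; auto; lia.
  - replace (fun x => forall n, (n < S N)%nat -> A n x)
      with (fun x => (forall n, (n < N)%nat -> A n x) /\ A N x).
    + apply Sigma0_setI; auto.
    + apply set_ext; intros x; split.
      * intros [H1 H2] n Hn; destruct (Nat.eq_dec n N) as [->|]; auto; apply H1; lia.
      * intros H; auto.
Qed.

End Borel.

(** * Independent open sets and diagonalization *)

Definition uncountable_set {X : Type} (S : X -> Prop) : Prop :=
  forall f : nat -> X, exists x, S x /\ forall n, f n <> x.

Section Scheme.
Context {X : Type} (d : X -> X -> R).
Context (Hd : is_metric d) (Hc : metric_complete d) (Hs : metric_separable d).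

(* All but countably many points of [S] are condensation points of [S]; take two of them. *)
Lemma uncountable_split (S : X -> Prop) (eps : R) : eps > 0 ->
  metric_open d (fun x => ~ S x) -> uncountable_set S ->
  exists T : bool -> X -> Prop,
    (forall b, metric_open d (fun x => ~ T b x)) /\
    (forall b, uncountable_set (T b)) /\
    (forall b x, T b x -> S x) /\
    (forall b x y, T b x -> T b y -> d x y <= eps) /\
    (forall x, T true x -> T false x -> False).
Proof.
  destruct Hd as [pos [d0 [sym tri]]]; destruct Hs as [s Hsep].
  intros Heps HS Hbig.
  set (C := fun i q y => S y /\ d (s i) y <= / INR (Datatypes.S q)).
  assert (He : forall p : nat * nat, exists f : nat -> X,
             ~ uncountable_set (C (fst p) (snd p)) ->
             forall x, C (fst p) (snd p) x -> exists n, f n = x).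
  { intros [i q]; simpl.
    destruct (classic (uncountable_set (C i q))) as [H|H]; [exists s; tauto|].
    apply not_all_ex_not in H as [f Hf]; exists f; intros _ x Hx.
    apply NNPP; intros Hn; apply Hf; exists x; split; auto.
    intros n Hn'; apply Hn; exists n; auto. }
  apply choice in He as [e He].
  (* [all] runs through the points of all countable traces [C i q] of closed balls, so a point of S
     outside it has only uncountable traces around it. *)
  set (all := fun n => let (i, m) := Cantor.of_nat n in e (Cantor.of_nat i) m).
  assert (Hcond : forall x, S x -> (forall n, all n <> x) ->
             forall i q, C i q x -> uncountable_set (C i q)).
  { intros x Sx Hx i q Cx; apply NNPP; intros H.
    destruct (He (i, q) H x Cx) as [m Hm].
    apply (Hx (Cantor.to_nat (Cantor.to_nat (i, q), m))).
    unfold all; rewrite !Cantor.cancel_of_to; exact Hm. }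
  destruct (Hbig all) as [x [Sx Hx]].
  destruct (Hbig (fun n => match n with O => x | Datatypes.S n => all n end)) as [y [Sy Hy]].
  assert (Hxy : 0 < d x y).
  { destruct (pos x y) as [H|H]; auto.
    exfalso; apply (Hy 0%nat); apply d0; auto. }
  (* A radius below eps / 2 bounds the diameters by eps. A radius below d x y / 4 separates the
     pieces: a path from x to y through the two centres and a common point consists of four
     radii. *)
  destruct (inv_INR_small (Rmin (eps / 2) (d x y / 4))) as [q Hq].
  { apply Rmin_pos; lra. }
  assert (Hq1 : / INR (Datatypes.S q) < eps / 2)
    by (apply Rlt_le_trans with (1 := Hq); apply Rmin_l).
  assert (Hq2 : / INR (Datatypes.S q) < d x y / 4)
    by (apply Rlt_le_trans with (1 := Hq); apply Rmin_r).
  assert (Hq0 := inv_INR_pos q).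
  destruct (Hsep x _ Hq0) as [i Hi]; destruct (Hsep y _ Hq0) as [j Hj].
  assert (Hclosed : forall k, metric_open d (fun u => ~ C k q u)).
  { intros k u Hu; unfold C in *.
    destruct (classic (S u)) as [Su|Su].
    - assert (H : / INR (Datatypes.S q) < d (s k) u) by
        (apply Rnot_le_lt; intros H; apply Hu; auto).
      exists (d (s k) u - / INR (Datatypes.S q)); split; [lra|].
      intros v Hv [_ H']; specialize (tri (s k) v u); rewrite (sym v u) in tri; lra.
    - destruct (HS u Su) as [r [Hr1 Hr2]]; exists r; split; auto.
      intros v Hv [Sv _]; exact (Hr2 v Hv Sv). }
  exists (fun b : bool => if b then C i q else C j q); repeat split.
  - intros []; apply Hclosed.
  - intros [].
    + apply Hcond with x; auto; split; auto; rewrite sym; lra.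
    + apply Hcond with y; auto; [|split; auto; rewrite sym; lra].
      intros n; apply (Hy (Datatypes.S n)).
  - intros [] z [H _]; exact H.
  - intros b u v Hu Hv.
    assert (H : exists k, d (s k) u <= / INR (Datatypes.S q) /\ d (s k) v <= / INR (Datatypes.S q)).
    { destruct b; destruct Hu as [_ Hu]; destruct Hv as [_ Hv]; [exists i | exists j]; auto. }
    destruct H as [k [H1 H2]].
    specialize (tri u (s k) v); rewrite (sym u (s k)) in tri; lra.
  - intros z [_ H1] [_ H2].
    assert (T1 := tri x (s i) y); assert (T2 := tri (s i) z y); assert (T3 := tri z (s j) y).
    rewrite (sym z (s j)) in T3; rewrite (sym y (s j)) in Hj; lra.
Qed.

Lemma closed_bigcup_words (n : nat) (T : list bool -> X -> Prop) :
  (forall w, metric_open d (fun x => ~ T w x)) ->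
  metric_open d (fun x => ~ exists w, length w = n /\ T w x).
Proof.
  revert T; induction n as [|n IH]; intros T HT.
  - replace (fun x => ~ exists w, length w = 0%nat /\ T w x) with (fun x => ~ T nil x);
      [apply HT|].
    apply set_ext; intros x; split.
    + intros H [[|b w] [Hw Hx]]; [auto | discriminate].
    + intros H Hx; apply H; exists nil; auto.
  - replace (fun x => ~ exists w, length w = S n /\ T w x)
      with (fun x => ~ (exists w, length w = n /\ T (true :: w)%list x) /\
                     ~ (exists w, length w = n /\ T (false :: w)%list x)).
    + apply metric_open_setI; apply (IH (fun w => T (_ :: w)%list)); auto.
    + apply set_ext; intros x; split.
      * intros [H1 H2] [[|[] w] [Hw Hx]]; [discriminate| |];
          [apply H1 | apply H2]; exists w; auto.
      * intros H; split; intros [w [Hw Hx]]; apply H;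
          [exists (true :: w)%list | exists (false :: w)%list]; simpl; auto.
Qed.

(** A Cantor scheme of uncountable closed sets with shrinking diameters. Completeness puts a point
    on every branch, and disjointness of the pieces of one level makes its bits readable. [O n] is
    defined as the complement of the finitely many closed pieces with bit n false, since the union
    of those with bit n true would be closed, not open. *)
Lemma independent_open_sets : @uncountable_type X ->
  exists O : nat -> X -> Prop, (forall n, metric_open d (O n)) /\
    forall y : nat -> Prop, exists x, forall n, O n x <-> y n.
Proof.
  intros Hunc.
  set (good := fun S : X -> Prop => metric_open d (fun x => ~ S x) /\ uncountable_set S).
  assert (Hstep : forall p : (X -> Prop) * nat, exists T : bool -> X -> Prop,
    good (fst p) ->
    (forall b, good (T b)) /\ (forall b x, T b x -> fst p x) /\
    (forall b x y, T b x -> T b y -> d x y <= / INR (S (snd p))) /\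
    (forall x, T true x -> T false x -> False)).
  { intros [S n]; simpl.
    destruct (classic (good S)) as [[H1 H2]|H]; [|exists (fun _ => S); tauto].
    destruct (uncountable_split S (/ INR (Datatypes.S n)) (inv_INR_pos n) H1 H2)
      as [T [HT1 [HT2 [HT3 [HT4 HT5]]]]].
    exists T; intros _; unfold good; auto. }
  apply choice in Hstep as [step Hstep].
  (* Words grow at the head: the newest bit comes first and the tail is the parent piece. *)
  set (Sw := fix Sw (w : list bool) : X -> Prop :=
         match w with
         | nil => fun _ => True
         | (b :: w)%list => step (Sw w, length w) b
         end).
  assert (Hgood : forall w, good (Sw w)).
  { intros w; induction w as [|b w IH].
    - split.
      + intros x Hx; exfalso; apply Hx; exact I.
      + intros f; destruct (Hunc f) as [x Hx]; exists x; split; [exact I | exact Hx].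
    - destruct (Hstep (Sw w, length w) IH) as [H _]; apply H. }
  assert (Hsub : forall b w x, Sw (b :: w)%list x -> Sw w x).
  { intros b w; destruct (Hstep (Sw w, length w) (Hgood w)) as [_ [H _]]; apply H. }
  assert (Hdiam : forall b w x y, Sw (b :: w)%list x -> Sw (b :: w)%list y ->
             d x y <= / INR (S (length w))).
  { intros b w; destruct (Hstep (Sw w, length w) (Hgood w)) as [_ [_ [H _]]]; apply H. }
  assert (Hdisj : forall w x, Sw (true :: w)%list x -> Sw (false :: w)%list x -> False).
  { intros w; destruct (Hstep (Sw w, length w) (Hgood w)) as [_ [_ [_ H]]]; apply H. }
  assert (Huniq : forall w w' x, length w = length w' -> Sw w x -> Sw w' x -> w = w').
  { intros w; induction w as [|b w IH]; intros [|b' w'] x Hl Hw Hw';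
      try discriminate; auto.
    injection Hl as Hl.
    assert (w = w') as <- by (apply IH with x; auto; eapply Hsub; eauto).
    destruct b, b'; auto; exfalso; apply (Hdisj w x); auto. }
  exists (fun n x => ~ exists w, length w = n /\ Sw (false :: w)%list x); split.
  - intros n; apply (closed_bigcup_words n (fun w => Sw (false :: w)%list)).
    intros w; apply (Hgood (false :: w)%list).
  - intros y.
    set (bit := fun n => if excluded_middle_informative (y n) then true else false).
    set (yw := fix yw n := match n with O => nil | S n => (bit n :: yw n)%list end).
    assert (Hlen : forall n, length (yw n) = n)
      by (intros n; induction n; simpl; auto).
    assert (Hu : forall n, exists x, Sw (yw n) x).
    { intros n; destruct (Hgood (yw n)) as [_ H].
      destruct Hs as [s _]; destruct (H s) as [x [Hx _]]; exists x; exact Hx. }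
    apply choice in Hu as [u Hu].
    assert (Hmono : forall m n x, (m <= n)%nat -> Sw (yw n) x -> Sw (yw m) x).
    { intros m n x Hmn; induction Hmn as [|n Hmn IH]; auto.
      intros H; apply IH; exact (Hsub _ _ _ H). }
    destruct (Hc u) as [l Hl].
    { intros eps Heps; destruct (inv_INR_small eps Heps) as [N HN].
      exists (S N); intros m n Hm Hn.
      apply Rle_lt_trans with (2 := HN).
      rewrite <- (Hlen N); apply (Hdiam (bit N)).
      - apply (Hmono (S N) m); auto.
      - apply (Hmono (S N) n); auto. }
    assert (Hin : forall n, Sw (yw n) l).
    { intros n; apply NNPP; intros H.
      destruct (Hgood (yw n)) as [Hcl _].
      destruct (Hcl l H) as [r [Hr1 Hr2]].
      destruct (Hl r Hr1) as [N HN].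
      apply (Hr2 (u (Nat.max N n))).
      - destruct Hd as [_ [_ [sym _]]]; rewrite sym; apply HN; lia.
      - apply (Hmono n (Nat.max N n)); auto; lia. }
    exists l; intros n; assert (Hn := Hin (S n)); simpl yw in Hn; unfold bit in Hn.
    destruct (excluded_middle_informative (y n)) as [Hy|Hy].
    + split; auto; intros _ [w [Hw Hw']].
      assert (E : (false :: w)%list = (true :: yw n)%list).
      { apply Huniq with l; auto; simpl; rewrite Hlen; auto. }
      discriminate E.
    + split; [|tauto].
      intros H; exfalso; apply H; exists (yw n); auto.
Qed.

End Scheme.

Section Universal.
Context {X : Type} (d : X -> X -> R) (tau : (X -> Prop) -> Prop).
Context (Hd : is_metric d) (Hs : metric_separable d).
Context (Htau : forall U, tau U <-> metric_open d U).

Lemma countable_base : exists V : nat -> X -> Prop, (forall n, metric_open d (V n)) /\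
  forall U, metric_open d U -> forall x, U x -> exists n, V n x /\ forall y, V n y -> U y.
Proof.
  destruct Hd as [_ [_ [sym tri]]]; destruct Hs as [s Hsep].
  exists (fun n y => let (i, q) := Cantor.of_nat n in d (s i) y < / INR (S q)); split.
  - intros n; destruct (Cantor.of_nat n) as [i q]; apply metric_open_ball; exact Hd.
  - intros U HU x Ux; destruct (HU x Ux) as [r [Hr1 Hr2]].
    destruct (inv_INR_small (r / 2)) as [q Hq]; [lra|].
    destruct (Hsep x _ (inv_INR_pos q)) as [i Hi].
    exists (Cantor.to_nat (i, q)); rewrite Cantor.cancel_of_to; split.
    + rewrite sym; exact Hi.
    + intros y Hy; apply Hr2; specialize (tri x (s i) y); lra.
Qed.

(* [U rho x] reads the code of a set off the bits [O (rho n) x] of the point [x] itself. *)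
Lemma Sigma0_universal (O : nat -> X -> Prop) (HO : forall n, metric_open d (O n))
  (z : ord) : ole o1 z ->
  exists U : (nat -> nat) -> X -> Prop,
    (forall rho, Sigma0 tau z (U rho)) /\
    forall A, Sigma0 tau z A -> exists y : nat -> Prop,
      forall rho x, (forall n, O (rho n) x <-> y n) -> (U rho x <-> A x).
Proof.
  induction (olt_wf z) as [z _ IH]; intros Hz.
  destruct (oeq_o1_or_o2_le z Hz) as [H1|H2].
  - destruct countable_base as [V [HV1 HV2]].
    exists (fun rho x => exists n, O (rho n) x /\ V n x); split.
    + intros rho; apply (Sigma0_metric_open d tau Hd Htau); auto.
      apply metric_open_bigcup; intros n; apply metric_open_setI; auto.
    + intros A HA; apply Sigma0_o1_inv, Htau in HA; auto.
      exists (fun n => forall y, V n y -> A y); intros rho x Hx; split.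
      * intros [n [Hn1 Hn2]]; apply (proj1 (Hx n) Hn1); exact Hn2.
      * intros Ax; destruct (HV2 A HA x Ax) as [n [Hn1 Hn2]].
        exists n; split; auto; apply (proj2 (Hx n)); exact Hn2.
  - destruct (olt_enum z H2) as [e [He1 He2]].
    assert (HU : forall i, exists U : (nat -> nat) -> X -> Prop,
      (forall rho, Sigma0 tau (e i) (U rho)) /\
      forall A, Sigma0 tau (e i) A -> exists y : nat -> Prop,
        forall rho x, (forall n, O (rho n) x <-> y n) -> (U rho x <-> A x)).
    { intros i; destruct (He1 i); apply IH; auto. }
    apply choice in HU as [U HU].
    (* k encodes a class index and a piece number, because the class of each piece of the union
       depends on the coded set. For each piece one class index is used; the other pairs receive a
       code of the whole space, whose complement adds nothing to the union. *)
    exists (fun rho x => exists k,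
      ~ U (fst (Cantor.of_nat k)) (fun m => rho (Cantor.to_nat (k, m))) x); split.
    + intros rho; apply Sigma0_union with (fun k x =>
        ~ U (fst (Cantor.of_nat k)) (fun m => rho (Cantor.to_nat (k, m))) x);
        [exact H2 | | intros x; reflexivity].
      intros k; exists (e (fst (Cantor.of_nat k))).
      rewrite not_not_set; destruct (He1 (fst (Cantor.of_nat k))).
      repeat split; auto; apply HU.
    + intros A HA; apply Sigma0_union_inv in HA as [B [HB HAB]]; auto.
      assert (Hi : forall n, exists i, Pi0 tau (e i) (B n)).
      { intros n; destruct (HB n) as [z' [Hz1 [Hz2 Hz3]]].
        destruct (He2 z' Hz1 Hz2) as [i [Hi _]]; exists i.
        apply (Sigma0_le d tau Hd Htau) with z'; auto. }
      apply choice in Hi as [idx Hidx].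
      assert (Hy : forall k, exists y : nat -> Prop, forall rho x,
        (forall n, O (rho n) x <-> y n) ->
        (U (fst (Cantor.of_nat k)) rho x <->
         ~ (fst (Cantor.of_nat k) = idx (snd (Cantor.of_nat k)) /\ B (snd (Cantor.of_nat k)) x))).
      { intros k; destruct (Cantor.of_nat k) as [i n]; simpl.
        destruct (Nat.eq_dec i (idx n)) as [->|Hne].
        - destruct (HU (idx n)) as [_ Hun]; destruct (Hun _ (Hidx n)) as [y Hy].
          exists y; intros rho x Hx; rewrite (Hy rho x Hx); tauto.
        - destruct (HU i) as [_ Hun]; destruct (Hun (fun _ => True)) as [y Hy].
          + apply (Sigma0_const d tau Hd Htau); apply He1.
          + exists y; intros rho x Hx; rewrite (Hy rho x Hx); tauto. }
      apply choice in Hy as [y Hy].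
      exists (fun n => let (k, m) := Cantor.of_nat n in y k m).
      intros rho x Hx.
      assert (Hk : forall k, ~ U (fst (Cantor.of_nat k)) (fun m => rho (Cantor.to_nat (k, m))) x <->
        (fst (Cantor.of_nat k) = idx (snd (Cantor.of_nat k)) /\ B (snd (Cantor.of_nat k)) x)).
      { intros k; rewrite (Hy k (fun m => rho (Cantor.to_nat (k, m))) x).
        - split; [apply NNPP | tauto].
        - intros m; rewrite Hx, Cantor.cancel_of_to; reflexivity. }
      rewrite HAB; split.
      * intros [k Hk']; apply Hk in Hk' as [_ Hk']; eauto.
      * intros [n Hn]; exists (Cantor.to_nat (idx n, n)); apply Hk.
        rewrite Cantor.cancel_of_to; auto.
Qed.

(** Set number i reads its code from column i of the bits of x. The columns are independent, so a
    single point can carry codes of all the [Q i] at once, and at that point the two families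
    agree. *)
Lemma Pi0_diagonal (Hc : metric_complete d) (HX : @uncountable_type X)
  (w : nat -> ord) (Hw : forall i, ole o1 (w i)) :
  exists S : nat -> X -> Prop, (forall i, Pi0 tau (w i) (S i)) /\
    forall Q : nat -> X -> Prop, (forall i, Pi0 tau (w i) (Q i)) ->
      exists x, forall i, S i x <-> Q i x.
Proof.
  destruct (independent_open_sets d Hd Hc Hs HX) as [O [HO1 HO2]].
  assert (HU := fun i => Sigma0_universal O HO1 (w i) (Hw i)).
  apply choice in HU as [U HU].
  exists (fun i x => ~ U i (fun m => Cantor.to_nat (i, m)) x); split.
  - intros i; unfold Pi0; rewrite not_not_set; apply HU.
  - intros Q HQ.
    assert (Hy := fun i => proj2 (HU i) _ (HQ i)); apply choice in Hy as [y Hy].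
    destruct (HO2 (fun n => let (i, m) := Cantor.of_nat n in y i m)) as [x Hx].
    exists x; intros i; rewrite (Hy i (fun m => Cantor.to_nat (i, m)) x).
    + split; [apply NNPP | tauto].
    + intros m; rewrite Hx, Cantor.cancel_of_to; reflexivity.
Qed.

End Universal.

(** * Finer Polish topologies *)

Definition metric_cv {X : Type} (d : X -> X -> R) (u : nat -> X) (x : X) : Prop :=
  forall eps, eps > 0 -> exists N, forall n, (N <= n)%nat -> d (u n) x < eps.

(** Sequential form of: the graph of x |-> (phi n x)_n is closed in the product of X with countably
    many lines. Such a graph is Polish, and its topology carried back to X is the refinement
    sought. *)
Definition closed_graph {X : Type} (d : X -> X -> R) (phi : nat -> X -> R) : Prop :=
  forall u x a, metric_cv d u x -> (forall n, Un_cv (fun k => phi n (u k)) (a n)) ->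
    forall n, a n = phi n x.

Definition pseudo_separable {X : Type} (rho : X -> X -> R) : Prop :=
  exists s : nat -> X, forall x r, r > 0 -> exists n, rho x (s n) < r.

Lemma lt_fin_bound (f : nat -> R) (N : nat) (r : R) :
  (forall n, (n < N)%nat -> f n < r) ->
  exists r', r' < r /\ forall n, (n < N)%nat -> f n <= r'.
Proof.
  induction N as [|N IH]; intros H.
  - exists (r - 1); split; [lra | lia].
  - destruct IH as [r' [H1 H2]]; [auto|].
    exists (Rmax r' (f N)); split.
    + apply Rmax_lub_lt; auto.
    + intros n Hn; destruct (Nat.eq_dec n N) as [->|].
      * apply Rmax_r.
      * apply Rle_trans with r'; [apply H2; lia | apply Rmax_l].
Qed.

Lemma nat_floor (x : R) : 0 <= x -> exists n : nat, INR n <= x < INR n + 1.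
Proof.
  intros Hx; destruct (INR_unbounded x) as [N HN].
  induction N as [|N IH]; [simpl in HN; lra|].
  destruct (Rle_dec (INR N) x) as [H|H].
  - exists N; rewrite S_INR in HN; lra.
  - apply IH; lra.
Qed.

Lemma int_approx (x : R) : exists a b : nat, Rabs (x - (INR a - INR b)) <= 1.
Proof.
  destruct (Rle_dec 0 x) as [H|H].
  - destruct (nat_floor x H) as [n Hn]; exists n, 0%nat; simpl.
    apply Rabs_le; lra.
  - destruct (nat_floor (- x)) as [n Hn]; [lra|]; exists 0%nat, n; simpl.
    apply Rabs_le; lra.
Qed.

(** A point is chosen in every nonempty cell given by a ball around [s i] and a grid interval of
    [phi], the grid integers being written as differences a - b. Two points of a cell are within
    twice the mesh, hence the choice of r / 2. *)
Lemma pseudo_separable_Rmax {X : Type} (rho : X -> X -> R) (phi : X -> R) :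
  (forall x y, rho x y = rho y x) ->
  (forall x y z, rho x z <= rho x y + rho y z) ->
  pseudo_separable rho ->
  pseudo_separable (fun x y => Rmax (rho x y) (Rabs (phi x - phi y))).
Proof.
  intros sym tri [s Hs].
  set (good := fun (p : (nat * nat) * (nat * nat)) x =>
    let '((i, q), (a, b)) := p in
    rho (s i) x < / INR (S q) /\
    Rabs (phi x - (INR a - INR b) * / INR (S q)) <= / INR (S q)).
  assert (Ht : forall p, exists y, forall x, good p x -> good p y).
  { intros p; destruct (classic (exists y, good p y)) as [[y Hy]|H]; [exists y; auto|].
    exists (s 0%nat); intros x Hx; exfalso; apply H; exists x; exact Hx. }
  apply choice in Ht as [t Ht].
  exists (fun n => let (k, l) := Cantor.of_nat n in t (Cantor.of_nat k, Cantor.of_nat l)).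
  intros x r Hr.
  destruct (inv_INR_small (r / 2)) as [q Hq]; [lra|].
  assert (Hq0 := inv_INR_pos q).
  destruct (Hs x _ Hq0) as [i Hi].
  destruct (int_approx (phi x * INR (S q))) as [a [b Hab]].
  assert (HI : INR (S q) <> 0) by (apply not_0_INR; lia).
  assert (Hg : good ((i, q), (a, b)) x).
  { split; [rewrite sym; exact Hi|].
    replace (phi x - (INR a - INR b) * / INR (S q))
      with ((phi x * INR (S q) - (INR a - INR b)) * / INR (S q)) by (field; exact HI).
    rewrite Rabs_mult, (Rabs_right (/ INR (S q))) by lra.
    apply Rle_trans with (1 * / INR (S q)); [apply Rmult_le_compat_r; lra | lra]. }
  apply Ht in Hg as Hg'; destruct Hg as [_ Hg]; destruct Hg' as [Hg1 Hg2].
  exists (Cantor.to_nat (Cantor.to_nat (i, q), Cantor.to_nat (a, b))).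
  rewrite !Cantor.cancel_of_to.
  apply Rmax_lub_lt.
  - eapply Rle_lt_trans; [apply tri with (y := s i)|]; lra.
  - set (c := (INR a - INR b) * / INR (S q)) in *.
    replace (phi x - phi (t (i, q, (a, b))))
      with ((phi x - c) + - (phi (t (i, q, (a, b))) - c)) by ring.
    eapply Rle_lt_trans; [apply Rabs_triang|]; rewrite Rabs_Ropp; lra.
Qed.

(** * The topology generated by [d] and countably many real coordinates *)

Section Refine.
Context {X : Type} (d : X -> X -> R) (tau : (X -> Prop) -> Prop).
Context (Hd : is_metric d) (Hc : metric_complete d) (Hs : metric_separable d).
Context (Htau : forall U, tau U <-> metric_open d U).

Section Join.
Context (phi : nat -> X -> R).

Let rho (n : nat) (x y : X) : R :=
  match n with O => d x y | S n => Rabs (phi n x - phi n y) end.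

Lemma join_rho_sym (n : nat) (x y : X) : rho n x y = rho n y x.
Proof. destruct n; simpl; [apply Hd | apply Rabs_minus_sym]. Qed.

Lemma join_rho_tri (n : nat) (x y z : X) : rho n x z <= rho n x y + rho n y z.
Proof.
  destruct n as [|n]; simpl; [apply Hd|].
  replace (phi n x - phi n z) with ((phi n x - phi n y) + (phi n y - phi n z)) by ring.
  apply Rabs_triang.
Qed.

Lemma join_rho_pos (n : nat) (x y : X) : 0 <= rho n x y.
Proof. destruct n as [|n]; simpl; [apply Hd | apply Rabs_pos]. Qed.

Lemma join_rho_diag (n : nat) (x : X) : rho n x x = 0.
Proof.
  destruct n as [|n]; simpl; [apply Hd; auto|].
  rewrite Rminus_diag; apply Rabs_R0.
Qed.

Lemma join_rho_separable (N : nat) : exists s : nat -> X, forall x r, r > 0 ->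
  exists k, forall n, (n <= N)%nat -> rho n x (s k) < r.
Proof.
  set (rmax := fix rmax N := match N with
    | O => d
    | S N => fun x y => Rmax (rmax N x y) (Rabs (phi N x - phi N y))
    end).
  assert (Hle : forall N n x y, (n <= N)%nat -> rho n x y <= rmax N x y).
  { intros M; induction M as [|M IH]; intros n x y Hn.
    - replace n with 0%nat by lia; apply Rle_refl.
    - destruct (Nat.eq_dec n (S M)) as [->|]; [apply Rmax_r|].
      eapply Rle_trans; [apply IH; lia | apply Rmax_l]. }
  assert (Hsym : forall N x y, rmax N x y = rmax N y x).
  { intros M; induction M as [|M IH]; intros x y; simpl; [apply Hd|].
    rewrite IH, Rabs_minus_sym; reflexivity. }
  assert (Htri : forall N x y z, rmax N x z <= rmax N x y + rmax N y z).
  { intros M; induction M as [|M IH]; intros x y z; simpl; [apply Hd|].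
    apply Rmax_lub.
    - eapply Rle_trans; [apply IH with (y := y)|].
      apply Rplus_le_compat; apply Rmax_l.
    - eapply Rle_trans; [apply (join_rho_tri (S M) x y z)|].
      apply Rplus_le_compat; apply Rmax_r. }
  assert (Hsep : forall N, pseudo_separable (rmax N)).
  { intros M; induction M as [|M IH]; [exact Hs|].
    apply pseudo_separable_Rmax; auto. }
  destruct (Hsep N) as [s HsN]; exists s; intros x r Hr.
  destruct (HsN x r Hr) as [k Hk]; exists k; intros n Hn.
  eapply Rle_lt_trans; [apply Hle; exact Hn | exact Hk].
Qed.

(** [d'] is the supremum of the coordinate pseudometrics, the n-th one truncated at 1/(n+1). The
    truncation leaves only finitely many coordinates to check for [d' x y < r], so the product
    topology results. *)
Lemma join_metric : exists d' : X -> X -> R,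
  (forall x y r, d' x y <= r <-> forall n, Rmin (/ INR (S n)) (rho n x y) <= r).
Proof.
  assert (H : forall p : X * X, exists m,
    is_lub (fun r => exists n, r = Rmin (/ INR (S n)) (rho n (fst p) (snd p))) m).
  { intros [x y]; simpl.
    destruct (completeness (fun r => exists n, r = Rmin (/ INR (S n)) (rho n x y)))
      as [m Hm].
    - exists 1; intros r [n ->]; eapply Rle_trans; [apply Rmin_l|].
      replace 1 with (/ INR 1) by (simpl; field); apply inv_INR_anti; lia.
    - exists (Rmin (/ INR 1) (rho 0 x y)); exists 0%nat; reflexivity.
    - exists m; exact Hm. }
  apply choice in H as [m Hm].
  exists (fun x y => m (x, y)); intros x y r.
  destruct (Hm (x, y)) as [H1 H2]; simpl in *; split.
  - intros Hr n; eapply Rle_trans; [apply H1; exists n; reflexivity | exact Hr].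
  - intros Hr; apply H2; intros r' [n ->]; apply Hr.
Qed.

Section JoinMetric.
Context (d' : X -> X -> R).
Context (Hd' : forall x y r,
  d' x y <= r <-> forall n, Rmin (/ INR (S n)) (rho n x y) <= r).

Lemma join_rho_le (n : nat) (x y : X) : Rmin (/ INR (S n)) (rho n x y) <= d' x y.
Proof. apply (proj1 (Hd' x y (d' x y))); apply Rle_refl. Qed.

Lemma join_rho_lt (n : nat) (x y : X) (r : R) :
  d' x y < r -> r <= / INR (S n) -> rho n x y < r.
Proof.
  intros H1 H2; assert (H := join_rho_le n x y).
  unfold Rmin in H; destruct Rle_dec; lra.
Qed.

Lemma join_metric_lt (N : nat) (x y : X) (r : R) : / INR (S N) < r ->
  (forall n, (n < N)%nat -> Rmin (/ INR (S n)) (rho n x y) < r) -> d' x y < r.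
Proof.
  intros HN H; destruct (lt_fin_bound _ N r H) as [r' [Hr1 Hr2]].
  apply Rle_lt_trans with (Rmax r' (/ INR (S N))); [|apply Rmax_lub_lt; auto].
  apply Hd'; intros n; destruct (le_lt_dec N n) as [Hn|Hn].
  - eapply Rle_trans; [apply Rmin_l|].
    eapply Rle_trans; [apply inv_INR_anti; exact Hn | apply Rmax_r].
  - eapply Rle_trans; [apply Hr2; exact Hn | apply Rmax_l].
Qed.

Lemma join_is_metric : is_metric d'.
Proof.
  assert (H0 : forall x y, 0 <= d' x y).
  { intros x y; eapply Rle_trans; [|apply (join_rho_le 0)].
    apply Rmin_glb; [apply Rlt_le, inv_INR_pos | apply join_rho_pos]. }
  repeat split; auto.
  - intros H; apply Hd; assert (H1 := join_rho_le 0 x y); rewrite H in H1.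
    assert (H2 := inv_INR_pos 0); assert (H3 := join_rho_pos 0 x y).
    unfold Rmin in H1; destruct Rle_dec; simpl rho in *; lra.
  - intros <-; apply Rle_antisym; auto; apply Hd'; intros n.
    rewrite join_rho_diag; apply Rmin_r.
  - intros x y; apply Rle_antisym; apply Hd'; intros n;
      rewrite join_rho_sym; apply join_rho_le.
  - intros x y z; apply Hd'; intros n.
    eapply Rle_trans; [|apply Rplus_le_compat; apply (join_rho_le n)].
    assert (H1 := inv_INR_pos n); assert (H2 := join_rho_tri n x y z).
    assert (H3 := join_rho_pos n x y); assert (H4 := join_rho_pos n y z).
    unfold Rmin; repeat destruct Rle_dec; lra.
Qed.

(** A Cauchy sequence for [d'] converges for [d] and along every coordinate; the closed graph
    identifies the coordinate limits with the values at the [d]-limit. *)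
Lemma join_complete : closed_graph d phi -> metric_complete d'.
Proof.
  intros Hgr u Hu.
  assert (Hrho : forall n eps, eps > 0 -> exists N, forall k l,
    (N <= k)%nat -> (N <= l)%nat -> rho n (u k) (u l) < eps).
  { intros n eps Heps.
    destruct (Hu (Rmin eps (/ INR (S n)))) as [N HN].
    { apply Rmin_pos; [exact Heps | apply inv_INR_pos]. }
    exists N; intros k l Hk Hl.
    eapply Rlt_le_trans; [apply join_rho_lt; [apply HN; auto | apply Rmin_r] | apply Rmin_l]. }
  destruct (Hc u (Hrho 0%nat)) as [x Hx].
  assert (Hlim : forall n, exists a, Un_cv (fun k => phi n (u k)) a).
  { intros n; destruct (R_complete (fun k => phi n (u k))) as [a Ha].
    - intros eps Heps; destruct (Hrho (S n) eps Heps) as [N HN]; exists N.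
      intros k l Hk Hl; apply HN; auto.
    - exists a; exact Ha. }
  apply choice in Hlim as [a Ha].
  assert (Heq := Hgr u x a Hx Ha).
  exists x; intros eps Heps.
  destruct (inv_INR_small eps Heps) as [N HN].
  assert (H1 : forall n, exists K, forall k, (K <= k)%nat -> rho n (u k) x < eps).
  { intros [|n]; [apply Hx; exact Heps|].
    destruct (Ha n eps Heps) as [K HK]; exists K; intros k Hk.
    simpl; rewrite <- Heq; apply HK; exact Hk. }
  assert (H2 : forall M, exists K, forall k, (K <= k)%nat ->
    forall n, (n < M)%nat -> rho n (u k) x < eps).
  { intros M; induction M as [|M [K HK]]; [exists 0%nat; lia|].
    destruct (H1 M) as [K' HK']; exists (Nat.max K K'); intros k Hk n Hn.
    destruct (Nat.eq_dec n M) as [->|]; [apply HK' | apply HK]; lia. }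
  destruct (H2 N) as [K HK]; exists K; intros k Hk.
  apply join_metric_lt with N; auto; intros n Hn.
  eapply Rle_lt_trans; [apply Rmin_r | apply HK; auto].
Qed.

Lemma join_separable : metric_separable d'.
Proof.
  assert (H := join_rho_separable); apply choice in H as [s Hsep].
  exists (fun i => let (N, k) := Cantor.of_nat i in s N k).
  intros x r Hr; destruct (inv_INR_small r Hr) as [N HN].
  destruct (Hsep N x r Hr) as [k Hk].
  exists (Cantor.to_nat (N, k)); rewrite Cantor.cancel_of_to.
  apply join_metric_lt with N; auto; intros n Hn.
  eapply Rle_lt_trans; [apply Rmin_r | apply Hk; lia].
Qed.

Lemma join_open_rho (n : nat) (U : X -> Prop) :
  (forall x, U x -> exists r, r > 0 /\ forall y, rho n x y < r -> U y) ->
  metric_open d' U.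
Proof.
  intros HU x Ux; destruct (HU x Ux) as [r [Hr1 Hr2]].
  exists (Rmin r (/ INR (S n))); split; [apply Rmin_pos; [exact Hr1 | apply inv_INR_pos]|].
  intros y Hy; apply Hr2.
  eapply Rlt_le_trans; [apply join_rho_lt; [exact Hy | apply Rmin_r] | apply Rmin_l].
Qed.

Lemma join_open_Sigma0 (xi : ord) (U : X -> Prop) : ole o1 xi ->
  (forall n c r, Sigma0 tau xi (fun y => Rabs (phi n y - c) < r)) ->
  metric_open d' U -> Sigma0 tau xi U.
Proof.
  intros Hxi Hphi HU.
  assert (Hm := join_is_metric).
  assert (Hball : forall x r, r > 0 -> Sigma0 tau xi (fun y => d' x y < r)).
  { intros x r Hr; destruct (inv_INR_small r Hr) as [N HN].
    replace (fun y => d' x y < r)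
      with (fun y => forall n, (n < N)%nat -> Rmin (/ INR (S n)) (rho n x y) < r).
    - apply (Sigma0_bigcap_lt d tau Hd Htau); auto; intros n _.
      destruct (Rlt_dec (/ INR (S n)) r) as [H|H].
      + replace (fun y => Rmin (/ INR (S n)) (rho n x y) < r) with (fun _ : X => True);
          [apply (Sigma0_const d tau Hd Htau); auto|].
        apply set_ext; intros y; split; auto; intros _.
        eapply Rle_lt_trans; [apply Rmin_l | exact H].
      + replace (fun y => Rmin (/ INR (S n)) (rho n x y) < r) with (fun y => rho n x y < r).
        * destruct n as [|n]; simpl rho.
          -- apply (Sigma0_metric_open d tau Hd Htau); auto; apply metric_open_ball; exact Hd.
          -- replace (fun y => Rabs (phi n x - phi n y) < r)
               with (fun y => Rabs (phi n y - phi n x) < r); [apply Hphi|].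
             apply set_ext; intros y; rewrite Rabs_minus_sym; reflexivity.
        * apply set_ext; intros y; unfold Rmin; destruct Rle_dec; lra.
    - apply set_ext; intros y; split.
      + apply join_metric_lt; exact HN.
      + intros H n _; eapply Rle_lt_trans; [apply join_rho_le | exact H]. }
  destruct join_separable as [s Hsep].
  (* Countable union over all basic balls, with the inclusion of the ball in U kept as a condition
     that does not depend on x. *)
  replace U with (fun x => exists i, let (k, q) := Cantor.of_nat i in
     d' (s k) x < / INR (S q) /\ forall y, d' (s k) y < / INR (S q) -> U y).
  - apply (Sigma0_bigcup d tau Htau); auto; intros i.
    destruct (Cantor.of_nat i) as [k q].
    apply (Sigma0_setI d tau Hd Htau); auto.
    + apply Hball, inv_INR_pos.
    + apply (Sigma0_const d tau Hd Htau); auto.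
  - destruct Hm as [pos [d0 [sym tri]]].
    apply set_ext; intros x; split.
    + intros [i Hi]; destruct (Cantor.of_nat i) as [k q]; destruct Hi as [Hi1 Hi2]; auto.
    + intros Ux; destruct (HU x Ux) as [r [Hr1 Hr2]].
      destruct (inv_INR_small (r / 2)) as [q Hq]; [lra|].
      destruct (Hsep x _ (inv_INR_pos q)) as [k Hk].
      exists (Cantor.to_nat (k, q)); rewrite Cantor.cancel_of_to; split.
      * rewrite sym; exact Hk.
      * intros y Hy; apply Hr2; specialize (tri x (s k) y); lra.
Qed.

End JoinMetric.

Lemma join_topology : closed_graph d phi ->
  exists d' : X -> X -> R,
    is_metric d' /\ metric_complete d' /\ metric_separable d' /\
    (forall U, metric_open d U -> metric_open d' U) /\
    (forall n c r, metric_open d' (fun y => Rabs (phi n y - c) < r)) /\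
    (forall xi, ole o1 xi ->
      (forall n c r, Sigma0 tau xi (fun y => Rabs (phi n y - c) < r)) ->
      forall U, metric_open d' U -> Sigma0 tau xi U).
Proof.
  intros Hgr; destruct join_metric as [d' Hd']; exists d'.
  split; [apply join_is_metric; auto|].
  split; [apply join_complete; auto|].
  split; [apply join_separable; auto|].
  repeat split.
  - intros U HU; apply (join_open_rho d' Hd' 0); exact HU.
  - intros n c r; apply (join_open_rho d' Hd' (S n)); simpl; intros x Hx.
    exists (r - Rabs (phi n x - c)); split; [lra|].
    intros y Hy; replace (phi n y - c) with (- (phi n x - phi n y) + (phi n x - c)) by ring.
    eapply Rle_lt_trans; [apply Rabs_triang|]; rewrite Rabs_Ropp; lra.
  - intros xi Hxi Hphi U HU; apply (join_open_Sigma0 d' Hd'); auto.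
Qed.

End Join.
End Refine.

Definition indic {X : Type} (A : X -> Prop) (x : X) : R :=
  if excluded_middle_informative (A x) then 1 else 0.

Lemma indic_in {X : Type} (A : X -> Prop) (x : X) : A x -> indic A x = 1.
Proof. intros H; unfold indic; destruct excluded_middle_informative; tauto. Qed.

Lemma indic_out {X : Type} (A : X -> Prop) (x : X) : ~ A x -> indic A x = 0.
Proof. intros H; unfold indic; destruct excluded_middle_informative; tauto. Qed.

Lemma least_nat (P : nat -> Prop) : (exists n, P n) ->
  exists n, P n /\ forall m, (m < n)%nat -> ~ P m.
Proof.
  intros [n Hn]; induction n as [n IH] using (well_founded_induction lt_wf).
  destruct (classic (exists m, (m < n)%nat /\ P m)) as [[m [Hm1 Hm2]]|H].
  - exact (IH m Hm1 Hm2).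
  - exists n; split; auto; intros m Hm HP; apply H; exists m; auto.
Qed.

(** The shift by one reserves 0 for the points in no [D n]. Such an index serves both as a
    coordinate of the refined topology and as the function f itself. *)
Lemma first_index {X : Type} (D : nat -> X -> Prop) : exists p : X -> nat, forall x m,
  p x = m <-> match m with
              | O => forall n, ~ D n x
              | S n => D n x /\ forall j, (j < n)%nat -> ~ D j x
              end.
Proof.
  set (first := fun x m => match m with
    | O => forall n, ~ D n x
    | S n => D n x /\ forall j, (j < n)%nat -> ~ D j x
    end).
  assert (Hp : forall x, exists m, first x m /\ forall m', first x m' -> m' = m).
  { intros x; destruct (classic (exists n, D n x)) as [Hn|Hn].
    - destruct (least_nat _ Hn) as [n [Hn1 Hn2]]; exists (S n); split; [split; auto|].
      intros [|m] Hm; [exfalso; apply (Hm n); exact Hn1|]; destruct Hm as [Hm1 Hm2].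
      f_equal; destruct (lt_eq_lt_dec m n) as [[Hlt|Heq]|Hlt]; auto; exfalso.
      + exact (Hn2 m Hlt Hm1).
      + exact (Hm2 n Hlt Hn1).
    - exists 0%nat; split; [intros n H; apply Hn; exists n; exact H|].
      intros [|m] Hm; auto; exfalso; apply Hn; exists m; apply Hm. }
  apply choice in Hp as [p Hp]; exists p; intros x m.
  destruct (Hp x) as [Ha Hb]; split; [intros <-; exact Ha|].
  intros H; symmetry; apply Hb; exact H.
Qed.

Lemma Un_cv_eventually (u : nat -> R) (l : R) (N : nat) :
  (forall n, (N <= n)%nat -> u n = l) -> Un_cv u l.
Proof.
  intros H eps Heps; exists N; intros n Hn; rewrite H by exact Hn.
  unfold Rdist; rewrite Rminus_diag, Rabs_R0; exact Heps.
Qed.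

Lemma Un_cv_INR (p : nat -> nat) (a : R) : Un_cv (fun k => INR (p k)) a ->
  exists m N, a = INR m /\ forall k, (N <= k)%nat -> p k = m.
Proof.
  intros H; destruct (H (1 / 2)) as [N HN]; [lra|].
  assert (Hp : forall k, (N <= k)%nat -> p k = p N).
  { intros k Hk; assert (H1 := HN k Hk); assert (H2 := HN N (Nat.le_refl N)).
    unfold Rdist in *; apply Rabs_def2 in H1; apply Rabs_def2 in H2.
    destruct (lt_eq_lt_dec (p k) (p N)) as [[Hlt|Heq]|Hlt]; auto; exfalso;
      apply le_INR in Hlt; rewrite S_INR in Hlt; lra. }
  exists (p N), N; split; auto.
  apply UL_sequence with (1 := H); apply Un_cv_eventually with N.
  intros n Hn; rewrite Hp; auto.
Qed.

Lemma Un_cv_ind {X : Type} (A : X -> Prop) (u : nat -> X) (x : X) :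
  Un_cv (fun k => indic A (u k)) (indic A x) ->
  exists N, forall k, (N <= k)%nat -> (A (u k) <-> A x).
Proof.
  intros H; destruct (H (1 / 2)) as [N HN]; [lra|].
  exists N; intros k Hk; specialize (HN k Hk).
  unfold Rdist in HN; apply Rabs_def2 in HN; unfold indic in HN.
  destruct (excluded_middle_informative (A (u k))),
    (excluded_middle_informative (A x)); try tauto; lra.
Qed.

(** * Coordinates that make sets of class below xi clopen *)

Section ClosedGraph.
Context {X : Type} (d : X -> X -> R) (tau : (X -> Prop) -> Prop).
Context (Hd : is_metric d) (Htau : forall U, tau U <-> metric_open d U).

Lemma Sigma0_ind_preimage (xi : ord) (C : X -> Prop) (c r : R) : ole o1 xi ->
  Sigma0 tau xi C -> Sigma0 tau xi (fun x => ~ C x) ->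
  Sigma0 tau xi (fun y => Rabs (indic C y - c) < r).
Proof.
  intros Hxi H1 H2.
  replace (fun y => Rabs (indic C y - c) < r)
    with (fun y => (C y /\ Rabs (1 - c) < r) \/ (~ C y /\ Rabs (0 - c) < r)).
  - apply (Sigma0_setU d tau Htau); auto; apply (Sigma0_setI d tau Hd Htau); auto;
      apply (Sigma0_const d tau Hd Htau); auto.
  - apply set_ext; intros y; unfold indic; destruct excluded_middle_informative; tauto.
Qed.

Lemma Sigma0_INR_preimage (xi : ord) (p : X -> nat) (c r : R) : ole o1 xi ->
  (forall k, Sigma0 tau xi (fun y => p y = k)) ->
  Sigma0 tau xi (fun y => Rabs (INR (p y) - c) < r).
Proof.
  intros Hxi Hp.
  replace (fun y => Rabs (INR (p y) - c) < r)
    with (fun y => exists k, p y = k /\ Rabs (INR k - c) < r).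
  - apply (Sigma0_bigcup d tau Htau); auto; intros k.
    apply (Sigma0_setI d tau Hd Htau); auto; apply (Sigma0_const d tau Hd Htau); auto.
  - apply set_ext; intros y; split.
    + intros [k [<- H]]; exact H.
    + intros H; exists (p y); auto.
Qed.

Lemma metric_open_inv_preimage (h : X -> R) (c r : R) :
  (forall x y, h x <= h y + d x y) ->
  metric_open d (fun x => h x > 0 /\ Rabs (/ h x - c) < r).
Proof.
  destruct Hd as [_ [_ [sym _]]]; intros hlip.
  assert (habs : forall x y, Rabs (h x - h y) <= d x y).
  { intros x y; apply Rabs_le; assert (H1 := hlip x y); assert (H2 := hlip y x).
    rewrite (sym y x) in H2; lra. }
  (* Multiplying |1/h - c| < r by h removes the inverse: the condition becomes q > 0, and q is
     Lipschitz with constant |r| + |c|. *)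
  set (q := fun x => r * h x - Rabs (1 - c * h x)).
  assert (Hq : forall x, h x > 0 -> (Rabs (/ h x - c) < r <-> q x > 0)).
  { intros x Hx; unfold q.
    replace (1 - c * h x) with ((/ h x - c) * h x) by (field; lra).
    rewrite Rabs_mult, (Rabs_right (h x)) by lra.
    split; intros H; [|apply Rmult_lt_reg_r with (h x)]; nra. }
  assert (Hqlip : forall x y, q x - q y <= (Rabs r + Rabs c) * d x y).
  { intros x y; unfold q.
    assert (H1 : r * h x - r * h y <= Rabs r * d x y).
    { rewrite <- Rmult_minus_distr_l; eapply Rle_trans; [apply Rle_abs|].
      rewrite Rabs_mult; apply Rmult_le_compat_l; [apply Rabs_pos | auto]. }
    assert (H2 : Rabs (1 - c * h y) - Rabs (1 - c * h x) <= Rabs c * d x y).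
    { eapply Rle_trans; [apply Rabs_triang_inv|].
      replace (1 - c * h y - (1 - c * h x)) with (c * (h x - h y)) by ring.
      rewrite Rabs_mult; apply Rmult_le_compat_l; [apply Rabs_pos | auto]. }
    lra. }
  intros x [Hx1 Hx2]; apply Hq in Hx2; auto.
  set (K := Rabs r + Rabs c + 1).
  assert (HK : K > 0) by (assert (H1 := Rabs_pos r); assert (H2 := Rabs_pos c); unfold K; lra).
  assert (Hr : q x / K > 0) by (apply Rdiv_lt_0_compat; lra).
  exists (Rmin (h x) (q x / K)); split; [apply Rmin_pos; lra|].
  intros y Hy.
  assert (Hy1 : d x y < h x) by (eapply Rlt_le_trans; [exact Hy | apply Rmin_l]).
  assert (Hy2 : d x y < q x / K) by (eapply Rlt_le_trans; [exact Hy | apply Rmin_r]).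
  assert (Hhy : h y > 0) by (specialize (hlip x y); lra).
  split; auto; apply Hq; auto.
  assert (H1 : K * d x y < q x).
  { apply Rmult_lt_compat_l with (r := K) in Hy2; auto.
    replace (K * (q x / K)) with (q x) in Hy2 by (field; lra); exact Hy2. }
  specialize (Hqlip x y); assert (H0 : 0 <= d x y) by apply Hd; unfold K in H1; lra.
Qed.

(** The indicator alone has no closed graph in general, as points outside C may converge into C. The
    coordinate 1/h blows up along such a sequence and excludes it; the identity
    [psi x * h x = 1 - indic C x] carries this to the limit. *)
Lemma closed_set_closed_graph (C : X -> Prop) : metric_open d (fun x => ~ C x) ->
  exists phi : nat -> X -> R, closed_graph d phi /\ phi 0%nat = indic C /\
    forall xi, olt o1 xi -> forall n c r, Sigma0 tau xi (fun y => Rabs (phi n y - c) < r).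
Proof.
  intros HC; destruct (open_lipschitz_witness d Hd _ HC) as [h [h01 [hlip hU]]].
  set (psi := fun x => if excluded_middle_informative (C x) then 0 else / h x).
  assert (hC : forall x, C x -> h x = 0).
  { intros x Cx; destruct (h01 x) as [[H|H] _]; auto.
    exfalso; apply hU in H; auto. }
  assert (Hpsi : forall x, psi x * h x = 1 - indic C x).
  { intros x; unfold psi, indic; destruct excluded_middle_informative as [H|H]; [ring|].
    apply hU in H; field; lra. }
  exists (fun n => match n with O => indic C | _ => psi end); split; [|split; auto].
  - intros u x a Hu Ha.
    assert (Hh : Un_cv (fun k => h (u k)) (h x)).
    { intros eps Heps; destruct (Hu eps Heps) as [N HN]; exists N; intros n Hn.
      specialize (HN n Hn); unfold Rdist; assert (H1 := hlip (u n) x).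
      assert (H2 := hlip x (u n)); destruct Hd as [_ [_ [sym _]]].
      rewrite (sym x) in H2; apply Rabs_def1; lra. }
    assert (Hprod := fun m => CV_mult _ _ _ _ (Ha (S m)) Hh); simpl in Hprod.
    assert (HCx : exists N, forall k, (N <= k)%nat -> (C (u k) <-> C x)).
    { destruct (classic (C x)) as [Cx|Cx].
      - assert (H := Hprod 0%nat); rewrite (hC x Cx), Rmult_0_r in H.
        destruct (H (1 / 2)) as [N HN]; [lra|]; exists N; intros k Hk.
        specialize (HN k Hk); unfold Rdist in HN; rewrite Hpsi in HN.
        apply Rabs_def2 in HN; unfold indic in HN.
        destruct excluded_middle_informative; [tauto | lra].
      - assert (Hx := proj1 (hU x) Cx).
        destruct (Hh (h x) Hx) as [N HN]; exists N; intros k Hk.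
        specialize (HN k Hk); unfold Rdist in HN; apply Rabs_def2 in HN.
        assert (~ C (u k)) by (apply hU; lra); tauto. }
    destruct HCx as [N HN]; intros [|n].
    + apply UL_sequence with (1 := Ha 0%nat); apply Un_cv_eventually with N.
      intros k Hk; specialize (HN k Hk); unfold indic.
      destruct (excluded_middle_informative (C (u k))),
        (excluded_middle_informative (C x)); tauto.
    + destruct (classic (C x)) as [Cx|Cx].
      * apply UL_sequence with (1 := Ha (S n)); apply Un_cv_eventually with N.
        intros k Hk; assert (Ck := proj2 (HN k Hk) Cx); unfold psi.
        destruct (excluded_middle_informative (C (u k))),
          (excluded_middle_informative (C x)); tauto.
      * assert (Hx := proj1 (hU x) Cx).
        apply Rmult_eq_reg_r with (h x); [|lra].
        rewrite Hpsi, indic_out by exact Cx.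
        apply UL_sequence with (1 := Hprod n); apply Un_cv_eventually with N.
        intros k Hk; rewrite Hpsi, indic_out; [reflexivity|].
        intros Ck; apply Cx, (HN k Hk); exact Ck.
  - intros xi Hxi n c r.
    assert (Hxi1 : ole o1 xi) by (apply olt_ole; exact Hxi).
    assert (HC1 : Sigma0 tau xi C).
    { apply Pi0_Sigma0 with o1; auto using ole_refl.
      apply (Sigma0_metric_open d tau Hd Htau); auto using ole_refl. }
    destruct n as [|n].
    + apply Sigma0_ind_preimage; auto; apply (Sigma0_metric_open d tau Hd Htau); auto.
    + replace (fun y => Rabs (psi y - c) < r)
        with (fun y => (h y > 0 /\ Rabs (/ h y - c) < r) \/ (C y /\ Rabs (0 - c) < r)).
      * apply (Sigma0_setU d tau Htau); auto.
        -- apply (Sigma0_metric_open d tau Hd Htau); auto.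
           apply metric_open_inv_preimage; exact hlip.
        -- apply (Sigma0_setI d tau Hd Htau); auto; apply (Sigma0_const d tau Hd Htau); auto.
      * apply set_ext; intros y; unfold psi; specialize (hU y).
        destruct excluded_middle_informative; tauto.
Qed.

(** The complement of C is a union of sets [D i] of lower class. To the coordinates of all the [D i]
    is added the first index of a [D i] containing x: if it converges, it is eventually constant, so
    a sequence cannot slip into C by running through later and later [D i]. It plays the part of 1/h
    in the closed case. *)
Lemma Pi0_closed_graph (z : ord) (C : X -> Prop) : ole o1 z -> Pi0 tau z C ->
  exists phi : nat -> X -> R, closed_graph d phi /\ phi 0%nat = indic C /\
    forall xi, olt z xi -> forall n c r, Sigma0 tau xi (fun y => Rabs (phi n y - c) < r).
Proof.
  revert C; induction (olt_wf z) as [z _ IH]; intros C Hz HC.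
  destruct (oeq_o1_or_o2_le z Hz) as [H1|H2].
  - apply Sigma0_o1_inv, Htau in HC; auto.
    destruct (closed_set_closed_graph C HC) as [phi [Hp1 [Hp2 Hp3]]].
    exists phi; repeat split; auto; intros xi Hxi; apply Hp3.
    apply ole_trans with (OS z); auto; exact Hz.
  - apply Sigma0_union_inv in HC as HC'; auto; destruct HC' as [D [HD HCD]].
    assert (Hph : forall i, exists phi : nat -> X -> R, closed_graph d phi /\
      phi 0%nat = indic (D i) /\ forall xi, ole z xi ->
        forall n c r, Sigma0 tau xi (fun y => Rabs (phi n y - c) < r)).
    { intros i; destruct (HD i) as [z' [Hz1 [Hz2 Hz3]]].
      destruct (IH z' Hz2 (D i) Hz1 Hz3) as [phi [Hp1 [Hp2 Hp3]]].
      exists phi; repeat split; auto; intros xi Hxi; apply Hp3.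
      apply ole_trans with z; auto. }
    apply choice in Hph as [ph Hph].
    destruct (first_index D) as [p HpE].
    assert (HCp : forall x, C x <-> p x = 0%nat).
    { intros x; rewrite HpE; simpl; specialize (HCD x); split.
      - intros Cx n Hn; apply HCD; auto; exists n; exact Hn.
      - intros Hn; apply NNPP; intros Cx; apply HCD in Cx as [n Hn']; exact (Hn n Hn'). }
    exists (fun n => match n with
      | O => indic C
      | S O => fun x => INR (p x)
      | S (S n) => let (i, b) := Cantor.of_nat n in ph i b
      end); split; [|split; auto].
    + intros u x a Hu Ha.
      assert (HDx : forall i b, a (S (S (Cantor.to_nat (i, b)))) = ph i b x).
      { intros i b.
        apply (proj1 (Hph i) u x (fun b => a (S (S (Cantor.to_nat (i, b))))) Hu).
        intros b'; assert (H := Ha (S (S (Cantor.to_nat (i, b'))))); cbv beta iota in H.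
        rewrite Cantor.cancel_of_to in H; exact H. }
      assert (HDu : forall i, exists N, forall k, (N <= k)%nat -> (D i (u k) <-> D i x)).
      { intros i; apply Un_cv_ind.
        destruct (Hph i) as [_ [H0 _]]; rewrite <- H0, <- HDx.
        assert (H := Ha (S (S (Cantor.to_nat (i, 0%nat))))); cbv beta iota in H.
        rewrite Cantor.cancel_of_to in H; exact H. }
      destruct (Un_cv_INR _ _ (Ha 1%nat)) as [m [N [Ham HN]]].
      (* Membership in [D i] is eventually constant along u, so it transfers from x to far terms of
         u, whose first index is already m. *)
      assert (HDN : forall i (P : Prop),
        (forall k, (N <= k)%nat -> D i (u k) -> P) -> D i x -> P).
      { intros i P HP Hx; destruct (HDu i) as [N' HN'].
        apply (HP (Nat.max N N')); [lia | apply HN'; [lia | exact Hx]]. }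
      assert (Hpx : p x = m).
      { apply HpE; destruct m as [|m]; simpl.
        - intros i Di; apply (HDN i False); auto; intros k Hk Hi.
          apply (proj1 (HpE (u k) 0%nat) (HN k Hk) i Hi).
        - split.
          + destruct (HDu m) as [N' HN'].
            apply (HN' (Nat.max N N')); [lia|].
            apply (proj1 (HpE (u (Nat.max N N')) (S m))); apply HN; lia.
          + intros j Hj Dj; apply (HDN j False); auto; intros k Hk Hjk.
            apply (proj2 (proj1 (HpE (u k) (S m)) (HN k Hk)) j Hj Hjk). }
      intros [|[|n]].
      * apply UL_sequence with (1 := Ha 0%nat); apply Un_cv_eventually with N.
        intros k Hk; specialize (HN k Hk); simpl.
        assert (H : C (u k) <-> C x) by (rewrite !HCp, HN, Hpx; reflexivity).
        unfold indic; destruct (excluded_middle_informative (C (u k))),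
          (excluded_middle_informative (C x)); tauto.
      * rewrite Ham, Hpx; reflexivity.
      * destruct (Cantor.of_nat n) as [i b] eqn:E.
        rewrite <- HDx, <- E, Cantor.cancel_to_of; reflexivity.
    + intros xi Hxi n c r.
      assert (Hxi1 : ole o1 xi) by (apply ole_trans with z; [|apply olt_ole]; auto).
      assert (HCxi : Sigma0 tau xi C) by (apply Pi0_Sigma0 with z; auto).
      destruct n as [|[|n]].
      * apply Sigma0_ind_preimage; auto.
        apply (Sigma0_le d tau Hd Htau) with z; auto; apply olt_ole; exact Hxi.
      * apply Sigma0_INR_preimage; auto; intros [|k].
        -- replace (fun y => p y = 0%nat) with C; auto; apply set_ext; exact HCp.
        -- replace (fun y => p y = S k)
             with (fun y => D k y /\ forall j, (j < k)%nat -> ~ D j y)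
             by (apply set_ext; intros y; rewrite HpE; reflexivity).
           apply (Sigma0_setI d tau Hd Htau); auto.
           ++ destruct (HD k) as [z' [Hz1 [Hz2 Hz3]]].
              apply Pi0_Sigma0 with z'; auto.
              apply ole_trans with z; auto; apply olt_ole; auto.
           ++ apply (Sigma0_bigcap_lt d tau Hd Htau xi (fun j y => ~ D j y)); auto.
              intros j _; destruct (HD j) as [z' [Hz1 [Hz2 Hz3]]].
              apply (Sigma0_le d tau Hd Htau) with z'; auto.
              apply ole_trans with z; apply olt_ole; auto.
      * destruct (Cantor.of_nat n) as [i b]; apply (Hph i); apply olt_ole; exact Hxi.
Qed.

Lemma refine_topology (Hc : metric_complete d) (Hs : metric_separable d) (xi : ord)
  (w : nat -> ord) (S : nat -> X -> Prop) :
  (forall i, ole o1 (w i) /\ olt (w i) xi) -> (forall i, Pi0 tau (w i) (S i)) ->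
  exists d' : X -> X -> R,
    is_metric d' /\ metric_complete d' /\ metric_separable d' /\
    (forall U, metric_open d U -> metric_open d' U) /\
    (forall i, metric_open d' (S i) /\ metric_open d' (fun x => ~ S i x)) /\
    (forall U, metric_open d' U -> Sigma0 tau xi U).
Proof.
  intros Hw HS.
  assert (Hph := fun i => Pi0_closed_graph (w i) (S i) (proj1 (Hw i)) (HS i)).
  apply choice in Hph as [ph Hph].
  destruct (join_topology d tau Hd Hc Hs Htau
    (fun n => let (i, b) := Cantor.of_nat n in ph i b)) as [d' [H1 [H2 [H3 [H4 [H5 H6]]]]]].
  { intros u x a Hu Ha n.
    destruct (Cantor.of_nat n) as [i b] eqn:E.
    rewrite <- (Cantor.cancel_to_of n), E.
    apply (proj1 (Hph i) u x (fun b => a (Cantor.to_nat (i, b))) Hu).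
    intros b'; assert (H := Ha (Cantor.to_nat (i, b'))); cbv beta iota in H.
    rewrite Cantor.cancel_of_to in H; exact H. }
  exists d'; do 4 (split; auto); split.
  - intros i; assert (H := H5 (Cantor.to_nat (i, 0%nat))); cbv beta iota in H.
    rewrite Cantor.cancel_of_to in H; destruct (Hph i) as [_ [H0 _]]; rewrite H0 in H.
    split.
    + replace (S i) with (fun y => Rabs (indic (S i) y - 1) < 1); [apply H|].
      apply set_ext; intros y; unfold indic; destruct excluded_middle_informative;
        unfold Rabs; destruct Rcase_abs; split; intros; try tauto; lra.
    + replace (fun y => ~ S i y) with (fun y => Rabs (indic (S i) y - 0) < 1); [apply H|].
      apply set_ext; intros y; unfold indic; destruct excluded_middle_informative;
        unfold Rabs; destruct Rcase_abs; split; intros; try tauto; lra.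
  - apply H6.
    + destruct (Hw 0%nat) as [Ha Hb]; apply ole_trans with (w 0%nat); auto.
      apply olt_ole; exact Hb.
    + intros n; destruct (Cantor.of_nat n) as [i b]; apply (Hph i); apply Hw.
Qed.

End ClosedGraph.

(** * Baire classes *)

(** Covers both the continuous functions of a topology and the functions of Baire class below xi.
    The approximations of f and g are thus built once, for membership in class xi over [tau] and in
    class 1 over the refined topology. *)
Definition function_algebra {X : Type} (F : (X -> R) -> Prop) : Prop :=
  (forall c, F (fun _ => c)) /\
  (forall f g, F f -> F g -> F (fun x => f x + g x)) /\
  (forall f g, F f -> F g -> F (fun x => f x * g x)).

Section Algebra.
Context {X : Type} (F : (X -> R) -> Prop) (HF : function_algebra F).

Lemma algebra_indC (A : X -> Prop) : F (indic A) -> F (indic (fun x => ~ A x)).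
Proof.
  destruct HF as [Hcst [Hplus Hmult]]; intros HA.
  replace (indic (fun x => ~ A x)) with (fun x => 1 + (-1) * indic A x).
  - apply Hplus; [apply Hcst | apply (Hmult (fun _ => -1)); auto].
  - apply functional_extensionality; intros x; unfold indic.
    repeat destruct excluded_middle_informative; try tauto; lra.
Qed.

Lemma algebra_indI (A B : X -> Prop) :
  F (indic A) -> F (indic B) -> F (indic (fun x => A x /\ B x)).
Proof.
  destruct HF as [Hcst [Hplus Hmult]]; intros HA HB.
  replace (indic (fun x => A x /\ B x)) with (fun x => indic A x * indic B x); auto.
  apply functional_extensionality; intros x; unfold indic.
  repeat destruct excluded_middle_informative; try tauto; lra.
Qed.

Lemma algebra_ind_cst (P : Prop) : F (indic (fun _ => P)).
Proof.
  destruct HF as [Hcst _]; unfold indic; destruct excluded_middle_informative; apply Hcst.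
Qed.

Lemma algebra_ind_bigcap (A : nat -> X -> Prop) (N : nat) :
  (forall n, (n < N)%nat -> F (indic (A n))) ->
  F (indic (fun x => forall n, (n < N)%nat -> A n x)).
Proof.
  induction N as [|N IH]; intros HA.
  - replace (fun x => forall n, (n < 0)%nat -> A n x) with (fun _ : X => True).
    + apply algebra_ind_cst.
    + apply set_ext; intros x; split; auto; lia.
  - replace (fun x => forall n, (n < S N)%nat -> A n x)
      with (fun x => (forall n, (n < N)%nat -> A n x) /\ A N x).
    + apply algebra_indI; auto.
    + apply set_ext; intros x; split; auto.
      intros [H1 H2] n Hn; destruct (Nat.eq_dec n N) as [->|]; auto; apply H1; lia.
Qed.

Lemma algebra_ind_bigcup (A : nat -> X -> Prop) (N : nat) :
  (forall n, (n < N)%nat -> F (indic (A n))) ->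
  F (indic (fun x => exists n, (n < N)%nat /\ A n x)).
Proof.
  intros HA.
  replace (fun x => exists n, (n < N)%nat /\ A n x)
    with (fun x => ~ forall n, (n < N)%nat -> ~ A n x).
  - apply algebra_indC, (algebra_ind_bigcap (fun n x => ~ A n x)).
    intros n Hn; apply algebra_indC; auto.
  - apply set_ext; intros x; split.
    + intros H; apply not_all_ex_not in H as [n Hn]; exists n; tauto.
    + intros [n [Hn1 Hn2]] H; exact (H n Hn1 Hn2).
Qed.

Lemma algebra_sum (f : nat -> X -> R) (N : nat) : (forall n, F (f n)) ->
  F (fun x => sum_f_R0 (fun n => f n x) N).
Proof.
  destruct HF as [_ [Hplus _]]; intros Hf; induction N as [|N IH]; simpl; auto.
Qed.

Lemma algebra_pow (f : X -> R) (n : nat) : F f -> F (fun x => f x ^ n).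
Proof.
  destruct HF as [Hcst [_ Hmult]]; intros Hf; induction n as [|n IH]; simpl; auto.
Qed.

End Algebra.

Section BaireClasses.
Context {X : Type} (d : X -> X -> R) (tau : (X -> Prop) -> Prop).
Context (Hd : is_metric d) (Htau : forall U, tau U <-> metric_open d U).

Lemma continuous_tau_seq (f : X -> R) :
  continuous_tau tau f <->
  forall u x, metric_cv d u x -> Un_cv (fun n => f (u n)) (f x).
Proof.
  destruct Hd as [pos [d0 [sym tri]]]; split.
  - intros Hf u x Hu eps Heps.
    assert (HV : R_open (fun z => Rabs (z - f x) < eps)).
    { intros y Hy; exists (eps - Rabs (y - f x)); split; [lra|]; intros z Hz.
      replace (z - f x) with ((z - y) + (y - f x)) by ring.
      eapply Rle_lt_trans; [apply Rabs_triang | lra]. }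
    apply Hf, Htau in HV; destruct (HV x) as [r [Hr1 Hr2]].
    { rewrite Rminus_diag, Rabs_R0; exact Heps. }
    destruct (Hu r Hr1) as [N HN]; exists N; intros n Hn.
    apply Hr2; rewrite sym; apply HN; exact Hn.
  - intros Hf V HV; apply Htau; intros x Vx; apply NNPP; intros H.
    assert (Hu : forall n, exists y, d x y < / INR (S n) /\ ~ V (f y)).
    { intros n; apply NNPP; intros Hn; apply H; exists (/ INR (S n)).
      split; [apply inv_INR_pos|]; intros y Hy; apply NNPP; intros Vy.
      apply Hn; exists y; auto. }
    apply choice in Hu as [u Hu].
    destruct (HV _ Vx) as [r [Hr1 Hr2]].
    destruct (Hf u x) with (eps := r) as [N HN]; auto.
    + intros eps Heps; destruct (inv_INR_small eps Heps) as [N HN]; exists N.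
      intros n Hn; rewrite sym; destruct (Hu n) as [H1 _].
      apply inv_INR_anti in Hn; lra.
    + apply (proj2 (Hu N)); apply Hr2; apply HN; lia.
Qed.

Lemma continuous_algebra : function_algebra (continuous_tau tau).
Proof.
  repeat split.
  - intros c; apply continuous_tau_seq; intros u x _.
    apply Un_cv_eventually with 0%nat; auto.
  - intros f g Hf Hg; rewrite continuous_tau_seq in *; intros u x Hu.
    apply (CV_plus (fun n => f (u n)) (fun n => g (u n))); auto.
  - intros f g Hf Hg; rewrite continuous_tau_seq in *; intros u x Hu.
    apply (CV_mult (fun n => f (u n)) (fun n => g (u n))); auto.
Qed.

Lemma Baire_le (a b : ord) (f : X -> R) : ole a b -> Baire tau a f -> Baire tau b f.
Proof.
  intros Hab Hf; destruct Hf as [a f Hf | a fs f Hfs Hlim]; [apply Baire_cont; auto|].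
  apply Baire_lim with fs; auto; intros n; destruct (Hfs n) as [z [Hz1 Hz2]].
  exists z; split; auto; apply ole_trans with a; auto.
Qed.

Lemma Baire_op (op : R -> R -> R) :
  (forall f g, continuous_tau tau f -> continuous_tau tau g ->
     continuous_tau tau (fun x => op (f x) (g x))) ->
  (forall u v l m, Un_cv u l -> Un_cv v m -> Un_cv (fun n => op (u n) (v n)) (op l m)) ->
  forall xi f g, Baire tau xi f -> Baire tau xi g ->
    Baire tau xi (fun x => op (f x) (g x)).
Proof.
  intros Hcont Hop xi; induction (olt_wf xi) as [xi _ IH]; intros f g Hf Hg.
  assert (Hcst : forall l, Un_cv (fun _ => l) l)
    by (intros l; apply Un_cv_eventually with 0%nat; auto).
  destruct Hf as [xi f Hf | xi fs f Hfs Hflim].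
  - destruct Hg as [xi g Hg | xi gs g Hgs Hglim]; [apply Baire_cont; auto|].
    apply Baire_lim with (fun n x => op (f x) (gs n x)).
    + intros n; destruct (Hgs n) as [z [Hz1 Hz2]]; exists z; split; auto.
      apply IH; auto; apply Baire_cont; exact Hf.
    + intros x; apply (Hop (fun _ => f x)); auto.
  - destruct Hg as [xi g Hg | xi gs g Hgs Hglim].
    + apply Baire_lim with (fun n x => op (fs n x) (g x)).
      * intros n; destruct (Hfs n) as [z [Hz1 Hz2]]; exists z; split; auto.
        apply IH; auto; apply Baire_cont; exact Hg.
      * intros x; apply (Hop (fun n => fs n x) (fun _ => g x)); auto.
    + apply Baire_lim with (fun n x => op (fs n x) (gs n x)).
      * intros n; destruct (Hfs n) as [a [Ha1 Ha2]]; destruct (Hgs n) as [b [Hb1 Hb2]].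
        destruct (omax_lt a b xi Ha1 Hb1) as [c [Hac [Hbc Hc]]].
        exists c; split; auto.
        apply IH; auto; [apply Baire_le with a | apply Baire_le with b]; auto.
      * intros x; apply Hop; auto.
Qed.

Lemma Baire_algebra (xi : ord) : function_algebra (Baire tau xi).
Proof.
  destruct continuous_algebra as [Hcst [Hplus Hmult]]; repeat split.
  - intros c; apply Baire_cont; auto.
  - apply Baire_op; [exact Hplus | exact CV_plus].
  - apply Baire_op; [exact Hmult | exact CV_mult].
Qed.

Lemma Baire_lt_algebra (xi : ord) : ole o1 xi ->
  function_algebra (fun f => exists z, olt z xi /\ Baire tau z f).
Proof.
  intros Hxi; repeat split.
  - intros c; exists OZ; split; [exact Hxi | apply Baire_algebra].
  - intros f g [a [Ha1 Ha2]] [b [Hb1 Hb2]].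
    destruct (omax_lt a b xi Ha1 Hb1) as [c [Hac [Hbc Hc]]]; exists c; split; auto.
    apply Baire_algebra; [apply Baire_le with a | apply Baire_le with b]; auto.
  - intros f g [a [Ha1 Ha2]] [b [Hb1 Hb2]].
    destruct (omax_lt a b xi Ha1 Hb1) as [c [Hac [Hbc Hc]]]; exists c; split; auto.
    apply Baire_algebra; [apply Baire_le with a | apply Baire_le with b]; auto.
Qed.

Lemma Baire_ind (z : ord) (A : X -> Prop) : ole o1 z -> Sigma0 tau z A ->
  Baire tau z (indic A).
Proof.
  revert A; induction (olt_wf z) as [z _ IH]; intros A Hz HA.
  destruct (oeq_o1_or_o2_le z Hz) as [H1|H2].
  - apply Sigma0_o1_inv, Htau in HA; auto.
    destruct (open_lipschitz_witness d Hd A HA) as [h [h01 [hlip hA]]].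
    assert (Hh : continuous_tau tau h).
    { apply continuous_tau_seq; intros u x Hu eps Heps.
      destruct (Hu eps Heps) as [N HN]; exists N; intros n Hn; specialize (HN n Hn).
      assert (Ha := hlip (u n) x); assert (Hb := hlip x (u n)).
      destruct Hd as [_ [_ [sym _]]]; rewrite (sym x) in Hb.
      unfold Rdist; apply Rabs_def1; lra. }
    (* The functions 1 - (1 - h)^n: since 0 < h <= 1 on A and h = 0 off A, the power tends to 0 on A
       and stays 1 elsewhere. *)
    apply Baire_lim with (fun n x => 1 + (-1) * (1 + (-1) * h x) ^ n).
    + intros n; exists OZ; split; [exact Hz|]; apply Baire_cont.
      destruct continuous_algebra as [Hcst [Hplus Hmult]].
      apply Hplus; [apply Hcst|]; apply (Hmult (fun _ => -1)); [apply Hcst|].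
      apply (algebra_pow _ continuous_algebra).
      apply Hplus; [apply Hcst|]; apply (Hmult (fun _ => -1)); auto.
    + intros x; destruct (classic (A x)) as [Ax|Ax].
      * rewrite indic_in by exact Ax; apply hA in Ax; intros eps Heps.
        destruct (pow_lt_1_zero (1 + (-1) * h x)) with (y := eps) as [N HN]; auto.
        { specialize (h01 x); apply Rabs_def1; lra. }
        exists N; intros n Hn; unfold Rdist.
        replace (1 + -1 * (1 + -1 * h x) ^ n - 1) with (- (1 + -1 * h x) ^ n) by ring.
        rewrite Rabs_Ropp; apply HN; exact Hn.
      * rewrite indic_out by exact Ax; apply Un_cv_eventually with 0%nat; intros n _.
        assert (h x = 0) as ->.
        { destruct (h01 x) as [[H|H] _]; auto; exfalso; apply Ax, hA; exact H. }
        rewrite Rmult_0_r, Rplus_0_r, pow1; ring.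
  - destruct (Sigma0_union_inv tau z A H2 HA) as [B [HB HAB]].
    apply Baire_lim with (fun n => indic (fun x => exists i, (i < n)%nat /\ B i x)).
    + intros n; apply (algebra_ind_bigcup _ (Baire_lt_algebra z Hz)); intros i _.
      destruct (HB i) as [z' [Hz1 [Hz2 Hz3]]].
      rewrite <- (not_not_set (B i)); apply (algebra_indC _ (Baire_lt_algebra z Hz)).
      exists z'; auto.
    + intros x; destruct (classic (A x)) as [Ax|Ax].
      * rewrite indic_in by exact Ax; apply HAB in Ax as [i Hi].
        apply Un_cv_eventually with (S i); intros n Hn; apply indic_in.
        exists i; auto.
      * rewrite indic_out by exact Ax; apply Un_cv_eventually with 0%nat.
        intros n _; apply indic_out; intros [i [_ Hi]]; apply Ax, HAB; exists i; exact Hi.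
Qed.

End BaireClasses.

(** * Decision lists *)

Section Decision.
Context (rk : nat -> nat -> ord) (v : nat -> Prop).
Context (b : nat -> Prop) (c : nat -> nat -> Prop).

(** Priority between the entries of list k. Breaking ties of rank by the index makes the winner
    unique even when entries of equal rank give opposite answers. *)
Definition before (k i j : nat) : Prop :=
  olt (rk k i) (rk k j) \/ (ole (rk k i) (rk k j) /\ (i < j)%nat).

Definition first (k : nat) : Prop := b k /\ forall i, (i < k)%nat -> ~ b i.

Definition wins (k j : nat) : Prop := c k j /\ forall i, c k i -> ~ before k i j.

Definition decide : Prop := exists k j, first k /\ wins k j /\ v j.

Definition decide_upto (N : nat) : Prop :=
  exists k, (k < N)%nat /\ exists j, (j < N)%nat /\
    first k /\ (c k j /\ forall i, (i < N)%nat -> ~ (c k i /\ before k i j)) /\ v j.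

Lemma before_total (k i j : nat) : i <> j -> before k i j \/ before k j i.
Proof.
  unfold before; intros Hij.
  destruct (ole_or_olt (rk k i) (rk k j)); [|tauto].
  destruct (ole_or_olt (rk k j) (rk k i)); [|tauto].
  destruct (lt_eq_lt_dec i j) as [[H1|H1]|H1]; tauto.
Qed.

Lemma wins_exists (k j0 : nat) : c k j0 -> exists j, wins k j.
Proof.
  intros H0.
  assert (Hmin : exists j1, c k j1 /\ forall i, c k i -> ~ olt (rk k i) (rk k j1)).
  { remember (rk k j0) as r eqn:Er; revert j0 H0 Er.
    induction (olt_wf r) as [r _ IH]; intros j0 H0 ->.
    destruct (classic (exists i, c k i /\ olt (rk k i) (rk k j0))) as [[i [Hi1 Hi2]]|H].
    - apply (IH (rk k i) Hi2 i); auto.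
    - exists j0; split; auto; intros i Hi1 Hi2; apply H; exists i; auto. }
  destruct Hmin as [j1 [Hj1 Hmin]].
  destruct (least_nat (fun j => c k j /\ ole (rk k j) (rk k j1))) as [j [[Hj2 Hj3] Hj4]].
  { exists j1; split; auto using ole_refl. }
  exists j; split; auto; intros i Hi [H|[H1 H2]].
  - apply (Hmin i Hi); apply ole_trans with (rk k j); auto.
  - apply (Hj4 i H2); split; auto; apply ole_trans with (rk k j); auto.
Qed.

Lemma first_unique (k k' : nat) : first k -> first k' -> k = k'.
Proof.
  intros [H1 H2] [H3 H4]; destruct (lt_eq_lt_dec k k') as [[H|H]|H]; auto; exfalso.
  - exact (H4 k H H1).
  - exact (H2 k' H H3).
Qed.

Lemma wins_unique (k j j' : nat) : wins k j -> wins k j' -> j = j'.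
Proof.
  intros [H1 H2] [H3 H4]; apply NNPP; intros H.
  destruct (before_total k j j' H) as [Hb|Hb]; [apply (H4 j H1 Hb) | apply (H2 j' H3 Hb)].
Qed.

Lemma decide_first_wins (k j : nat) : first k -> wins k j -> (decide <-> v j).
Proof.
  intros Hk Hj; split.
  - intros [k' [j' [Hk' [Hj' Hv]]]].
    rewrite (first_unique _ _ Hk' Hk) in Hj'; rewrite (wins_unique _ _ _ Hj Hj'); exact Hv.
  - intros Hv; exists k, j; auto.
Qed.

(** Once N exceeds the first index k and the winner j, a different entry cannot win the truncated
    contest, because j itself precedes it. Each truncation is a finite Boolean combination, so the
    decided set has an indicator that is a limit of members of the algebra. *)
Lemma decide_upto_eventually :
  exists N, forall n, (N <= n)%nat -> (decide_upto n <-> decide).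
Proof.
  destruct (classic (exists k, first k)) as [[k Hk]|Hk].
  - destruct (classic (exists j, c k j)) as [[j0 Hj0]|Hj].
    + destruct (wins_exists k j0 Hj0) as [j Hj].
      exists (S (Nat.max k j)); intros n Hn.
      rewrite (decide_first_wins k j Hk Hj); split.
      * intros [k' [_ [j' [Hj'n [Hk' [[Hj'1 Hj'2] Hv]]]]]].
        assert (k' = k) as -> by (apply first_unique; auto).
        destruct (Nat.eq_dec j j') as [->|Hne]; auto; exfalso.
        destruct Hj as [Hj1 Hj2].
        destruct (before_total k j j' Hne) as [Hb|Hb].
        -- apply (Hj'2 j); [lia | auto].
        -- exact (Hj2 j' Hj'1 Hb).
      * intros Hv; exists k; split; [lia|]; exists j; split; [lia|].
        destruct Hj as [Hj1 Hj2]; repeat split; try apply Hk; auto.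
        intros i _ [Hi Hb]; exact (Hj2 i Hi Hb).
    + exists 0%nat; intros n _; split.
      * intros [k' [_ [j' [_ [Hk' [[Hj' _] _]]]]]].
        rewrite (first_unique _ _ Hk' Hk) in Hj'; exfalso; apply Hj; exists j'; exact Hj'.
      * intros [k' [j' [Hk' [[Hj' _] _]]]].
        rewrite (first_unique _ _ Hk' Hk) in Hj'; exfalso; apply Hj; exists j'; exact Hj'.
  - exists 0%nat; intros n _; split.
    + intros [k' [_ [j' [_ [Hk' _]]]]]; exfalso; apply Hk; exists k'; exact Hk'.
    + intros [k' [j' [Hk' _]]]; exfalso; apply Hk; exists k'; exact Hk'.
Qed.

End Decision.

(** * The functions f and g of a decision list as limits of simple functions *)

Section DecisionFunctions.
Context {X : Type} (rk : nat -> nat -> ord) (v : nat -> Prop).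
Context (B : nat -> X -> Prop) (C : nat -> nat -> X -> Prop).

Definition decided (x : X) : Prop := decide rk v (fun k => B k x) (fun k j => C k j x).

Context (lev : X -> nat).
Context (Hlev : forall x m, lev x = m <->
  match m with
  | O => forall n, ~ B n x
  | S n => first (fun k => B k x) n
  end).

Lemma decided_lev (x : X) : decided x -> lev x <> 0%nat.
Proof.
  intros [k [j [[Hk _] _]]] H; apply Hlev in H; exact (H k Hk).
Qed.

Section Limits.
Context (F : (X -> R) -> Prop) (HF : function_algebra F).
Context (HB : forall k, F (indic (B k))) (HC : forall k j, F (indic (C k j))).

Lemma algebra_first (k : nat) : F (indic (fun x => first (fun k => B k x) k)).
Proof.
  apply (algebra_indI F HF); auto.
  apply (algebra_ind_bigcap F HF (fun i x => ~ B i x)); intros i _.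
  apply (algebra_indC F HF); auto.
Qed.

(** At each point at most one term of the series is nonzero, so the partial sums are eventually
    constant; [a 0 = 0] accounts for the points in no [B k], where every term vanishes. *)
Lemma lev_limit (a : nat -> R) : a 0%nat = 0 ->
  exists fs : nat -> X -> R, (forall n, F (fs n)) /\
    forall x, Un_cv (fun n => fs n x) (a (lev x)).
Proof.
  intros Ha.
  exists (fun n x => sum_f_R0 (fun k => a (S k) * indic (fun x => first (fun k => B k x) k) x) n).
  split.
  - intros n; apply (algebra_sum F HF
      (fun k x => a (S k) * indic (fun x => first (fun k => B k x) k) x)); intros k.
    destruct HF as [Hcst [_ Hmult]].
    apply (Hmult (fun _ => a (S k))); [apply Hcst | apply algebra_first].
  - intros x.
    assert (Hsum : forall n,
      sum_f_R0 (fun k => a (S k) * indic (fun x => first (fun k => B k x) k) x) n =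
      if le_lt_dec (lev x) (S n) then a (lev x) else 0).
    { assert (Hterm : forall k, a (S k) * indic (fun x => first (fun k => B k x) k) x =
        if Nat.eq_dec (lev x) (S k) then a (lev x) else 0).
      { intros k; destruct Nat.eq_dec as [E|E].
        - rewrite indic_in, E; [ring | exact (proj1 (Hlev x (S k)) E)].
        - rewrite indic_out; [ring|]; intros H; apply E, (proj2 (Hlev x (S k)) H). }
      intros n; induction n as [|n IH]; simpl; rewrite ?IH, Hterm.
      - destruct Nat.eq_dec, le_lt_dec; auto; try lia.
        replace (lev x) with 0%nat by lia; auto.
      - destruct Nat.eq_dec, le_lt_dec, le_lt_dec; auto; try lia; try ring. }
    apply Un_cv_eventually with (lev x); intros n Hn; rewrite Hsum.
    destruct le_lt_dec; [reflexivity | lia].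
Qed.

Lemma decided_limit : exists fs : nat -> X -> R, (forall n, F (fs n)) /\
  forall x, Un_cv (fun n => fs n x) (indic decided x).
Proof.
  exists (fun N => indic (fun x => decide_upto rk v (fun k => B k x) (fun k j => C k j x) N)).
  split.
  - intros N; apply (algebra_ind_bigcup F HF); intros k _.
    apply (algebra_ind_bigcup F HF); intros j _.
    apply (algebra_indI F HF); [apply algebra_first|].
    apply (algebra_indI F HF); [|apply (algebra_ind_cst F HF)].
    apply (algebra_indI F HF); [apply HC|].
    apply (algebra_ind_bigcap F HF (fun i x => ~ (C k i x /\ before rk k i j))); intros i _.
    apply (algebra_indC F HF), (algebra_indI F HF); [apply HC | apply (algebra_ind_cst F HF)].
  - intros x.
    destruct (decide_upto_eventually rk v (fun k => B k x) (fun k j => C k j x)) as [N HN].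
    apply Un_cv_eventually with N; intros n Hn; specialize (HN n Hn).
    unfold indic, decided; repeat destruct excluded_middle_informative; tauto.
Qed.

End Limits.

(** The reciprocal of [INR m], extended by 0. The product with [dec_f] is 1 off level 0, and on
    level 0 nothing is decided, so f g is the indicator exactly. *)
Definition weight (m : nat) : R := match m with O => 0 | S k => / INR (S k) end.

Definition dec_f (x : X) : R := INR (lev x).
Definition dec_g (x : X) : R := weight (lev x) * indic decided x.

Lemma dec_fg : (fun x => dec_f x * dec_g x) = indic decided.
Proof.
  apply functional_extensionality; intros x; unfold dec_f, dec_g.
  destruct (lev x) as [|k] eqn:E.
  - rewrite indic_out; [ring|]; intros H; exact (decided_lev x H E).
  - unfold weight; field; apply not_0_INR; lia.
Qed.

Lemma dec_f_limit (F : (X -> R) -> Prop) (HF : function_algebra F) :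
  (forall k, F (indic (B k))) ->
  exists fs : nat -> X -> R, (forall n, F (fs n)) /\
    forall x, Un_cv (fun n => fs n x) (dec_f x).
Proof. intros HB; apply (lev_limit F HF HB INR); reflexivity. Qed.

Lemma dec_g_limit (F : (X -> R) -> Prop) (HF : function_algebra F) :
  (forall k, F (indic (B k))) -> (forall k j, F (indic (C k j))) ->
  exists fs : nat -> X -> R, (forall n, F (fs n)) /\
    forall x, Un_cv (fun n => fs n x) (dec_g x).
Proof.
  intros HB HC.
  destruct (lev_limit F HF HB weight eq_refl) as [fs [H1 H2]].
  destruct (decided_limit F HF HB HC) as [gs [H3 H4]].
  exists (fun n x => fs n x * gs n x); split.
  - intros n; apply HF; auto.
  - intros x; apply (CV_mult (fun n => fs n x) (fun n => gs n x)); auto.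
Qed.

End DecisionFunctions.

(** * Oscillation ranks *)

Section Derivatives.
Context {X : Type} (tau' : (X -> Prop) -> Prop) (f : X -> R) (eps : R).

Lemma Dalpha_anti (a b : ord) (x : X) :
  ole a b -> Dalpha tau' f eps b x -> Dalpha tau' f eps a x.
Proof.
  revert b x; induction a as [|a IHa|g IHa]; intros b x Hab Hx.
  - exact I.
  - revert x Hx; induction b as [|b IHb|g IHb]; intros x Hx.
    + destruct Hab.
    + destruct Hx as [Hx1 Hx2]; split; [apply IHa with b; auto|].
      intros U HU Ux; destruct (Hx2 U HU Ux) as [x1 [x2 [H1 [H2 [H3 [H4 H5]]]]]].
      exists x1, x2; repeat split; auto; apply IHa with b; auto.
    + destruct Hab as [n Hn]; apply (IHb n); auto; apply Hx.
  - intros n; apply (IHa n b); auto.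
Qed.

Lemma D1_out (F U : X -> Prop) (x : X) : tau' U -> U x ->
  (forall y z, F y -> U y -> F z -> U z -> Rabs (f y - f z) < eps) -> ~ D1 tau' f eps F x.
Proof.
  intros HU Ux H [_ Hx]; destruct (Hx U HU Ux) as [y [z [H1 [H2 [H3 [H4 H5]]]]]].
  specialize (H y z H1 H2 H3 H4); lra.
Qed.

(** Limit stages are intersections, so a point is always lost at a successor stage, where the
    oscillation near it on the preceding derivative is below [eps]. *)
Lemma Dalpha_exit (a : ord) (x : X) : ~ Dalpha tau' f eps a x ->
  exists c, olt c a /\ Dalpha tau' f eps c x /\ ~ Dalpha tau' f eps (OS c) x.
Proof.
  induction a as [|a IH|g IH]; intros Hx.
  - exfalso; apply Hx; exact I.
  - destruct (classic (Dalpha tau' f eps a x)) as [H|H].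
    + exists a; repeat split; auto; apply ole_refl.
    + destruct (IH H) as [c [Hc1 Hc2]]; exists c; split; auto.
      apply ole_S_r; exact Hc1.
  - apply not_all_ex_not in Hx as [n Hn]; destruct (IH n Hn) as [c [Hc1 Hc2]].
    exists c; split; auto; exists n; exact Hc1.
Qed.

Lemma Dalpha_closed (d' : X -> X -> R) (Htau' : forall U, tau' U <-> metric_open d' U)
  (a : ord) : tau' (fun x => ~ Dalpha tau' f eps a x).
Proof.
  apply Htau'; induction a as [|a IH|g IH]; intros x Hx.
  - exfalso; apply Hx; exact I.
  - destruct (classic (Dalpha tau' f eps a x)) as [H|H].
    + assert (HU : exists U, tau' U /\ U x /\ ~ exists x1 x2,
        Dalpha tau' f eps a x1 /\ U x1 /\ Dalpha tau' f eps a x2 /\ U x2 /\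
        Rabs (f x1 - f x2) >= eps).
      { apply NNPP; intros HN; apply Hx; split; auto; intros U HU Ux.
        apply NNPP; intros HN'; apply HN; exists U; auto. }
      destruct HU as [U [HU [Ux HN]]]; apply Htau' in HU as HU'.
      destruct (HU' x Ux) as [r [Hr1 Hr2]]; exists r; split; auto.
      intros y Hy [_ Hy']; apply HN, Hy'; auto.
    + destruct (IH x H) as [r [Hr1 Hr2]]; exists r; split; auto.
      intros y Hy [Hy' _]; exact (Hr2 y Hy Hy').
  - apply not_all_ex_not in Hx as [n Hn].
    destruct (IH n x Hn) as [r [Hr1 Hr2]]; exists r; split; auto.
    intros y Hy Hy'; exact (Hr2 y Hy (Hy' n)).
Qed.

End Derivatives.

Lemma metric_open_bigcap {X : Type} (d : X -> X -> R) (A : nat -> X -> Prop) (N : nat) :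
  (forall n, (n < N)%nat -> metric_open d (A n)) ->
  metric_open d (fun x => forall n, (n < N)%nat -> A n x).
Proof.
  induction N as [|N IH]; intros HA.
  - intros x _; exists 1; split; [lra | lia].
  - replace (fun x => forall n, (n < S N)%nat -> A n x)
      with (fun x => (forall n, (n < N)%nat -> A n x) /\ A N x).
    + apply metric_open_setI; auto.
    + apply set_ext; intros x; split; auto.
      intros [H1 H2] n Hn; destruct (Nat.eq_dec n N) as [->|]; auto; apply H1; lia.
Qed.

Lemma clopen_indic_continuous {X : Type} (d : X -> X -> R)
  (tau : (X -> Prop) -> Prop) (Htau : forall U, tau U <-> metric_open d U)
  (A : X -> Prop) : metric_open d A -> metric_open d (fun x => ~ A x) ->
  continuous_tau tau (indic A).
Proof.
  intros H1 H2 V _; apply Htau; intros x Vx.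
  destruct (classic (A x)) as [Ax|Ax].
  - destruct (H1 x Ax) as [r [Hr1 Hr2]]; exists r; split; auto; intros y Hy.
    rewrite indic_in in * by auto; exact Vx.
  - destruct (H2 x Ax) as [r [Hr1 Hr2]]; exists r; split; auto; intros y Hy.
    rewrite indic_out in * by auto; exact Vx.
Qed.

(** * Ranks of f and g when the sets of the list are clopen *)

Section UpperBound.
Context {X : Type} (rk : nat -> nat -> ord) (v : nat -> Prop).
Context (B : nat -> X -> Prop) (C : nat -> nat -> X -> Prop).
Context (lev : X -> nat).
Context (Hlev : forall x m, lev x = m <->
  match m with
  | O => forall n, ~ B n x
  | S n => first (fun k => B k x) n
  end).
Context (d : X -> X -> R) (tau : (X -> Prop) -> Prop).
Context (Htau : forall U, tau U <-> metric_open d U).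
Context (HB : forall k, metric_open d (B k) /\ metric_open d (fun x => ~ B k x)).
Context (HC : forall k j, metric_open d (C k j) /\ metric_open d (fun x => ~ C k j x)).

Lemma metric_open_lev (k : nat) : metric_open d (fun x => lev x = S k).
Proof.
  replace (fun x => lev x = S k) with (fun x => B k x /\ forall i, (i < k)%nat -> ~ B i x).
  - apply metric_open_setI; [apply HB|].
    apply (metric_open_bigcap d (fun i x => ~ B i x)); intros i _; apply HB.
  - apply set_ext; intros x; rewrite Hlev; reflexivity.
Qed.

Lemma beta_dec_f (L : ord) : ole o2 L -> beta_le tau (dec_f lev) L.
Proof.
  intros HL eps Heps; exists o2; split; auto; intros x Hx.
  assert (H0 : forall y, Dalpha tau (dec_f lev) eps o1 y -> lev y = 0%nat).
  { intros y Hy; destruct (lev y) as [|k] eqn:E; auto; exfalso; revert Hy.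
    apply D1_out with (fun z => lev z = S k); auto.
    - apply Htau, metric_open_lev.
    - intros z z' _ Hz _ Hz'; unfold dec_f; rewrite Hz, Hz', Rminus_diag, Rabs_R0; lra. }
  revert Hx; apply D1_out with (fun _ => True); auto.
  - apply Htau; intros y _; exists 1; split; auto; lra.
  - intros z z' Hz _ Hz' _; unfold dec_f.
    rewrite (H0 z Hz), (H0 z' Hz'), Rminus_diag, Rabs_R0; lra.
Qed.

Lemma dec_g_wins (k j : nat) (x : X) : lev x = S k ->
  wins rk (fun k j => C k j x) k j -> dec_g rk v B C lev x = / INR (S k) * indic (fun _ => v j) x.
Proof.
  intros Hx Hj; unfold dec_g; rewrite Hx; unfold weight; f_equal.
  assert (H : decided rk v B C x <-> v j).
  { apply decide_first_wins with k; auto; apply (proj1 (Hlev x (S k)) Hx). }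
  unfold indic; repeat destruct excluded_middle_informative; tauto.
Qed.

Lemma dec_g_no_trigger (k : nat) (x : X) : lev x = S k -> (forall j, ~ C k j x) ->
  dec_g rk v B C lev x = 0.
Proof.
  intros Hx Hn; unfold dec_g; rewrite indic_out; [ring|].
  intros [k' [j [Hk' [[Hj _] _]]]].
  assert (Hk := proj1 (Hlev x (S k)) Hx); simpl in Hk.
  rewrite (first_unique _ _ _ Hk' Hk) in Hj; exact (Hn j Hj).
Qed.

(** If an entry of rank at most a holds at x, let i be the one of least index. By induction only
    entries of rank at least a hold at points of D^a, so nothing of smaller rank competes with i
    there. Hence i wins on D^a near x, g is constant there, and x is not in the next derivative. *)
Lemma Dalpha_dec_g (eps : R) : eps > 0 -> forall (a : ord) (k j : nat) (x : X),
  Dalpha tau (dec_g rk v B C lev) eps a x -> lev x = S k -> C k j x -> ole a (rk k j).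
Proof.
  intros Heps a; induction a as [|a IH|h IH]; intros k j x Hx Hk Hj.
  - exact I.
  - assert (Ha : forall i y, Dalpha tau (dec_g rk v B C lev) eps a y ->
      lev y = S k -> C k i y -> ole a (rk k i)) by (intros i y; apply IH).
    destruct (ole_or_olt (rk k j) a) as [Hle|Hlt]; [|exact Hlt].
    exfalso; revert Hx.
    destruct (least_nat (fun i => C k i x /\ ole (rk k i) a)) as [i [[Hi1 Hi2] Hi3]].
    { exists j; auto. }
    (* Only the finitely many l < i have to be shut out, which keeps this neighbourhood open; a tie
       with a larger index is won by i. *)
    apply D1_out with (fun y => (lev y = S k /\ C k i y) /\
      forall l, (l < i)%nat -> ~ (C k l y /\ ole (rk k l) a)).
    + apply Htau, metric_open_setI.
      * apply metric_open_setI; [apply metric_open_lev | apply HC].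
      * apply (metric_open_bigcap d (fun l y => ~ (C k l y /\ ole (rk k l) a))); intros l _.
        destruct (classic (ole (rk k l) a)) as [Hl|Hl].
        -- replace (fun y => ~ (C k l y /\ ole (rk k l) a)) with (fun y => ~ C k l y);
             [apply HC | apply set_ext; tauto].
        -- intros y _; exists 1; split; [lra | tauto].
    + auto.
    + assert (Hval : forall y, Dalpha tau (dec_g rk v B C lev) eps a y ->
        (lev y = S k /\ C k i y) /\ (forall l, (l < i)%nat -> ~ (C k l y /\ ole (rk k l) a)) ->
        dec_g rk v B C lev y = / INR (S k) * indic (fun _ => v i) x).
      { intros y Hy [[Hy1 Hy2] Hy3]; rewrite (dec_g_wins k i y); auto.
        split; auto; intros l Hl [Hb|[Hb1 Hb2]].
        - apply (olt_irrefl a); apply ole_trans with (OS (rk k l)); [apply (Ha l y); auto|].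
          apply ole_trans with (rk k i); auto.
        - apply (Hy3 l Hb2); split; auto; apply ole_trans with (rk k i); auto. }
      intros y z Hy1 Hy2 Hz1 Hz2; rewrite (Hval y), (Hval z), Rminus_diag, Rabs_R0; auto.
  - intros n; apply (IH n k j x); auto.
Qed.

(** If a bounds the ranks of list k, no entry holds at points of D^(a+1) on level k + 1, so g
    vanishes there and one more derivative empties the level: hence a + 2. On level 0 a single
    derivative is enough. *)
Lemma beta_dec_g (L : ord) : ole o1 L ->
  (forall k, exists a, (forall j, ole (rk k j) a) /\ ole (OS (OS a)) L) ->
  beta_le tau (dec_g rk v B C lev) L.
Proof.
  intros HL Hrk eps Heps; exists L; split; [apply ole_refl|]; intros x Hx.
  destruct (lev x) as [|k] eqn:E.
  - apply (Dalpha_anti _ _ _ o1) in Hx; auto; revert Hx.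
    destruct (inv_INR_small eps Heps) as [K HK].
    (* Outside the first K cover sets g lies between 0 and 1/(K+1), which is below [eps]. *)
    apply D1_out with (fun y => forall k, (k < K)%nat -> ~ B k y).
    + apply Htau, (metric_open_bigcap d (fun k y => ~ B k y)); intros k _; apply HB.
    + intros k _; apply (proj1 (Hlev x 0%nat) E).
    + assert (Hsmall : forall y, (forall k, (k < K)%nat -> ~ B k y) ->
        0 <= dec_g rk v B C lev y <= / INR (S K)).
      { intros y Hy; assert (H0 := inv_INR_pos K).
        unfold dec_g, indic; destruct excluded_middle_informative as [Hd|Hd]; [|lra].
        destruct (lev y) as [|k] eqn:Ey; unfold weight; [lra|]; rewrite Rmult_1_r.
        assert (H1 := inv_INR_pos k).
        split; [lra|]; apply inv_INR_anti.
        destruct (le_lt_dec K k) as [Hk|Hk]; auto; exfalso.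
        destruct (proj1 (Hlev y (S k)) Ey) as [Hy1 _]; exact (Hy k Hk Hy1). }
      intros y z _ Hy _ Hz; apply Hsmall in Hy; apply Hsmall in Hz.
      apply Rabs_def1; lra.
  - destruct (Hrk k) as [a [Ha1 Ha2]].
    apply (Dalpha_anti _ _ _ (OS (OS a))) in Hx; auto; revert Hx.
    assert (Hval : forall y, Dalpha tau (dec_g rk v B C lev) eps (OS a) y ->
      lev y = S k -> dec_g rk v B C lev y = 0).
    { intros y Hy Ey; apply dec_g_no_trigger with k; auto; intros j Hj.
      apply (olt_irrefl a); apply ole_trans with (rk k j); auto.
      apply (Dalpha_dec_g eps Heps (OS a) k j y); auto. }
    apply D1_out with (fun y => lev y = S k); auto.
    + apply Htau, metric_open_lev.
    + intros y z Hy1 Hy2 Hz1 Hz2; rewrite (Hval y), (Hval z), Rminus_diag, Rabs_R0; auto.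
Qed.

End UpperBound.

(** * Coded decision lists for complements of sets of small rank *)

Section LowerBound.
Context {X : Type} (d : X -> X -> R) (tau : (X -> Prop) -> Prop).
Context (Hd : is_metric d) (Htau : forall U, tau U <-> metric_open d U).

(** A false guard leaves the empty set, which belongs to every class. This allows an index that
    announces a wrong class for its set to be kept harmlessly. *)
Lemma Pi0_guard (z : ord) (P : Prop) (D : X -> Prop) : ole o1 z ->
  (P -> Pi0 tau z D) -> Pi0 tau z (fun x => P /\ D x).
Proof.
  intros Hz HD; destruct (classic P) as [HP|HP].
  - replace (fun x => P /\ D x) with D; auto; apply set_ext; tauto.
  - unfold Pi0; replace (fun x => ~ (P /\ D x)) with (fun _ : X => True).
    + apply (Sigma0_const d tau Hd Htau); exact Hz.
    + apply set_ext; tauto.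
Qed.

Context (xi : ord) (Hxi : ole o2 xi) (e : nat -> ord).
Context (He1 : forall i, ole o1 (e i) /\ olt (e i) xi).
Context (He2 : forall b, ole o1 b -> olt b xi -> exists i, oeq b (e i)).

Lemma Sigma0_pieces (U : X -> Prop) : Sigma0 tau xi U ->
  exists D : nat -> X -> Prop, (forall m, exists a, Pi0 tau (e a) (D m)) /\
    forall x, U x <-> exists m, D m x.
Proof.
  intros HU; destruct (Sigma0_union_inv tau xi U Hxi HU) as [D [HD HUD]].
  exists D; split; auto; intros m; destruct (HD m) as [z [Hz1 [Hz2 Hz3]]].
  destruct (He2 z Hz1 Hz2) as [a [Ha _]]; exists a.
  apply (Sigma0_le d tau Hd Htau) with z; auto.
Qed.

Context (h : nat -> ord) (en : nat -> nat -> ord).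
Context (Hen : forall n b, ole b (h n) -> exists p, oeq b (en n p)).

(* The index [k] of a set [B k] encodes a triple (length [h n], Borel class, free
   parameter), the index [j] of an entry [C k j] encodes (rank, value, Borel class, free
   parameter), and a set index encodes [(k, 0)] for [B k] and [(k, S j)] for [C k j]. *)
Definition ix_len (k : nat) : nat := fst (Cantor.of_nat k).
Definition ix_rank (k j : nat) : ord := en (ix_len k) (fst (Cantor.of_nat j)).
Definition ix_val (j : nat) : nat := fst (Cantor.of_nat (snd (Cantor.of_nat j))).
Definition ix_par (i : nat) : nat * nat :=
  let (k, j) := Cantor.of_nat i in
  match j with
  | O => Cantor.of_nat (snd (Cantor.of_nat k))
  | S j => Cantor.of_nat (snd (Cantor.of_nat (snd (Cantor.of_nat j))))
  end.
Definition ix_class (i : nat) : ord := e (fst (ix_par i)).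

Definition ix_B (S : nat -> X -> Prop) (k : nat) : X -> Prop := S (Cantor.to_nat (k, 0%nat)).
Definition ix_C (S : nat -> X -> Prop) (k j : nat) : X -> Prop :=
  S (Cantor.to_nat (k, Datatypes.S j)).
(** Value 0 means acceptance. In [decide_complement] a nonzero value records membership in A, so
    accepting on 0 yields the complement. *)
Definition ix_decided (S : nat -> X -> Prop) : X -> Prop :=
  decided ix_rank (fun j => ix_val j = 0%nat) (ix_B S) (ix_C S).

(** An entry (n, p, s) holds at x if near x, on the derivative of order [en n p], membership in A is
    the constant s. It is right about x itself as soon as x lies in that derivative. If c is the
    last stage containing x, an entry of rank c holds; the winner then has rank at most c, and x
    lies in D^c, hence in the derivative of the winner. *)
Lemma decide_complement (tau' : (X -> Prop) -> Prop) (A : X -> Prop) :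
  Polish tau' -> (forall U, tau' U -> Sigma0 tau xi U) ->
  (forall x, ~ Dalpha tau' (indic A) 1 (OL h) x) ->
  exists Q : nat -> X -> Prop, (forall i, Pi0 tau (ix_class i) (Q i)) /\
    forall x, ix_decided Q x <-> ~ A x.
Proof.
  intros [d' [_ [_ [_ Hd']]]] Hsub Hempty.
  set (DA := Dalpha tau' (indic A) 1) in *.
  assert (HB' : forall n, exists D : nat -> X -> Prop,
    (forall m, exists a, Pi0 tau (e a) (D m)) /\
    forall x, ~ DA (h n) x <-> exists m, D m x).
  { intros n; apply Sigma0_pieces, Hsub; apply (Dalpha_closed _ _ _ d'); exact Hd'. }
  apply choice in HB' as [B' HB'].
  set (G := fun (t : nat * nat * nat) (x : X) =>
    let '(n, p, s) := t in
    exists O, tau' O /\ O x /\ forall y, O y -> DA (en n p) y -> (A y <-> s <> 0%nat)).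
  assert (HC' : forall t, exists D : nat -> X -> Prop,
    (forall m, exists a, Pi0 tau (e a) (D m)) /\ forall x, G t x <-> exists m, D m x).
  { intros [[n p] s]; apply Sigma0_pieces, Hsub, Hd'.
    intros x [O [HO1 [HO2 HO3]]]; apply Hd' in HO1 as HO.
    destruct (HO x HO2) as [r [Hr1 Hr2]]; exists r; split; auto.
    intros y Hy; exists O; auto. }
  apply choice in HC' as [C' HC'].
  set (piece := fun i => let (k, j) := Cantor.of_nat i in
    match j with
    | O => B' (ix_len k) (snd (ix_par i))
    | Datatypes.S j => C' (ix_len k, fst (Cantor.of_nat j), ix_val j) (snd (ix_par i))
    end).
  (* An index carries a class and a piece number that need not match; the guard empties the set when
     they do not. [BQ] and [CQ] recover each piece from an index announcing its true class. *)
  set (Q := fun i x => Pi0 tau (ix_class i) (piece i) /\ piece i x).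
  exists Q; split.
  { intros i; apply Pi0_guard; auto; apply He1. }
  assert (QB : forall k x, ix_B Q k x -> ~ DA (h (ix_len k)) x).
  { intros k x [_ H]; unfold piece in H; rewrite Cantor.cancel_of_to in H.
    apply (HB' (ix_len k)); eauto. }
  assert (QC : forall k j x, ix_C Q k j x ->
    G (ix_len k, fst (Cantor.of_nat j), ix_val j) x).
  { intros k j x [_ H]; unfold piece in H; rewrite Cantor.cancel_of_to in H.
    apply (HC' (ix_len k, fst (Cantor.of_nat j), ix_val j)); eauto. }
  assert (BQ : forall n x, ~ DA (h n) x -> exists k, ix_B Q k x).
  { intros n x Hx; apply HB' in Hx as [m Hm]; destruct (HB' n) as [Ha _].
    destruct (Ha m) as [a Ham].
    exists (Cantor.to_nat (n, Cantor.to_nat (a, m))); unfold ix_B, Q, ix_class, piece.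
    unfold ix_par; rewrite Cantor.cancel_of_to; unfold ix_len.
    rewrite !Cantor.cancel_of_to; cbn [fst snd].
    rewrite !Cantor.cancel_of_to; auto. }
  assert (CQ : forall k p s x, G (ix_len k, p, s) x ->
    exists j, ix_C Q k j x /\ fst (Cantor.of_nat j) = p).
  { intros k p s x Hx; apply HC' in Hx as [m Hm]; destruct (HC' (ix_len k, p, s)) as [Ha _].
    destruct (Ha m) as [a Ham].
    exists (Cantor.to_nat (p, Cantor.to_nat (s, Cantor.to_nat (a, m)))).
    unfold ix_C, Q, ix_class, piece, ix_par, ix_val.
    rewrite !Cantor.cancel_of_to; cbn [fst snd].
    rewrite !Cantor.cancel_of_to; cbn [fst snd].
    rewrite !Cantor.cancel_of_to; auto. }
  intros x.
  destruct (not_all_ex_not _ _ (Hempty x)) as [n Hn].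
  destruct (BQ n x Hn) as [k0 Hk0].
  (* The first index k may belong to another length than n, so the exit stage is sought below
     [h (ix_len k)]. *)
  destruct (least_nat (fun k => ix_B Q k x)) as [k [Hk1 Hk2]]; [exists k0; exact Hk0|].
  destruct (Dalpha_exit _ _ _ _ _ (QB k x Hk1)) as [c [Hc1 [Hc2 Hc3]]].
  destruct (Hen (ix_len k) c (olt_ole _ _ Hc1)) as [p [Hp1 Hp2]].
  assert (HG : G (ix_len k, p, if excluded_middle_informative (A x) then 1%nat else 0%nat) x).
  (* An indicator with no two values at distance at least 1 is constant; this is the reason for the
     threshold 1. *)
  { assert (HU : exists U, tau' U /\ U x /\ forall y, U y -> DA c y -> (A y <-> A x)).
    { apply NNPP; intros HN; apply Hc3; split; auto; intros U HU Ux.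
      apply NNPP; intros HN'; apply HN; exists U; do 2 (split; auto); intros y Uy Dy.
      apply NNPP; intros Hyx; apply HN'; exists y, x; do 4 (split; auto).
      unfold indic; repeat destruct excluded_middle_informative; try tauto;
        unfold Rabs; destruct Rcase_abs; lra. }
    destruct HU as [U [HU1 [HU2 HU3]]]; exists U; do 2 (split; auto); intros y Uy Dy.
    rewrite (HU3 y Uy); [|apply (Dalpha_anti _ _ _ _ (en (ix_len k) p)); auto].
    destruct excluded_middle_informative; split; auto; tauto. }
  destruct (CQ _ _ _ _ HG) as [j0 [Hj0 Ej0]].
  destruct (wins_exists ix_rank (fun k j => ix_C Q k j x) k j0 Hj0) as [j Hj].
  unfold ix_decided, decided.
  rewrite (decide_first_wins _ _ (fun k => ix_B Q k x) (fun k j => ix_C Q k j x) k j);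
    [|split; auto | exact Hj].
  destruct Hj as [Hj1 Hj2].
  assert (Hle : ole (ix_rank k j) c).
  { apply ole_trans with (ix_rank k j0).
    - destruct (ole_or_olt (ix_rank k j) (ix_rank k j0)) as [H|H]; auto.
      exfalso; apply (Hj2 j0 Hj0); left; exact H.
    - unfold ix_rank; rewrite Ej0; exact Hp2. }
  destruct (QC k j x Hj1) as [O [HO1 [HO2 HO3]]].
  assert (HA : A x <-> ix_val j <> 0%nat).
  { apply HO3; auto; apply (Dalpha_anti _ _ _ _ c); auto. }
  split; [intros H H'; apply HA in H'; auto|].
  intros H; apply NNPP; intros H'; apply H, HA; exact H'.
Qed.

End LowerBound.

Theorem theorem3p7 :
  forall (xi : ord), ole o2 xi ->
  forall (X : Type) (tau : (X -> Prop) -> Prop),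
    Polish tau -> @uncountable_type X ->
  forall (zeta : ord), olt OZ zeta ->
  exists f g : X -> R,
    Baire tau xi f /\ Baire tau xi g /\
    beta_star_le tau xi f (oexp_omega zeta) /\
    beta_star_le tau xi g (oexp_omega zeta) /\
    ~ beta_star_le tau xi (fun x => f x * g x) (oexp_omega zeta).
Proof.
  intros xi Hxi X tau [d [Hd [Hc [Hs Htau]]]] HX zeta Hzeta.
  destruct (oexp_omega_cofinal zeta Hzeta) as [h [Hh1 Hh2]].
  destruct (olt_enum xi Hxi) as [e [He1 He2]].
  assert (Hen := fun n => ole_enum (h n)); apply choice in Hen as [en Hen].
  set (L := oexp_omega zeta) in *.
  (* L is a limit ordinal. This leaves room for the two extra derivatives of g beyond [h n] and
     gives 2 <= L, the bound for f. *)
  assert (HLlim : forall a, olt a L -> olt (OS a) L).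
  { intros a Ha; destruct (ole_trans _ _ _ Ha Hh1) as [n Hn].
    apply ole_trans with (OS (h n)); [exact Hn | apply Hh2]. }
  assert (HL1 : ole o1 L) by apply oexp_omega_ge1.
  assert (HL2 : ole o2 L) by (apply (HLlim OZ); exact HL1).
  (* At each point x the sets [S i] display the cover and lists that x codes; they define both A and
     the functions f and g. *)
  destruct (Pi0_diagonal d tau Hd Hs Htau Hc HX (ix_class e)) as [S [HS Hdiag]].
  { intros i; apply He1. }
  destruct (first_index (ix_B S)) as [lev Hlev].
  set (rk := ix_rank en); set (v := fun j => ix_val j = 0%nat).
  assert (Hcls : forall i, ole o1 (ix_class e i) /\ olt (ix_class e i) xi)
    by (intros i; apply He1).
  assert (HalgX := Baire_lt_algebra d tau Hd Htau xi (ole_trans _ _ _ (ole_S o1) Hxi)).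
  assert (HindX : forall i, exists z, olt z xi /\ Baire tau z (indic (S i))).
  { intros i; rewrite <- (not_not_set (S i)); apply (algebra_indC _ HalgX).
    exists (ix_class e i); split; [apply Hcls|].
    apply (Baire_ind d tau Hd Htau); [apply Hcls | apply HS]. }
  destruct (refine_topology d tau Hd Htau Hc Hs xi (ix_class e) S Hcls HS)
    as [d' [Hd' [Hc' [Hs' [Hfine [Hclopen HSig]]]]]].
  assert (Htau' : forall U, metric_open d' U <-> metric_open d' U) by reflexivity.
  assert (Halg' := continuous_algebra d' (metric_open d') Hd' Htau').
  assert (Hind' : forall i, continuous_tau (metric_open d') (indic (S i))).
  { intros i; destruct (Hclopen i); apply clopen_indic_continuous with d'; auto. }
  assert (HT : forall f fs, (forall n, continuous_tau (metric_open d') (fs n)) ->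
    (forall x, Un_cv (fun n => fs n x) (f x)) -> T_f tau xi f (metric_open d')).
  { intros f fs Hfs Hlim; repeat split; auto.
    - exists d'; auto.
    - intros U HU; apply Hfine, Htau; exact HU.
    - apply Baire_lim with fs; auto; intros n; exists OZ; split; [exact I|].
      apply Baire_cont; auto. }
  exists (dec_f lev), (dec_g rk v (ix_B S) (ix_C S) lev).
  split; [|split; [|split; [|split]]].
  - destruct (dec_f_limit (ix_B S) lev Hlev _ HalgX) as [fs [H1 H2]];
      [intros k; apply HindX | apply Baire_lim with fs; auto].
  - destruct (dec_g_limit rk v (ix_B S) (ix_C S) lev Hlev _ HalgX) as [fs [H1 H2]];
      [intros k; apply HindX | intros k j; apply HindX | apply Baire_lim with fs; auto].
  - exists (metric_open d'); split.
    + destruct (dec_f_limit (ix_B S) lev Hlev _ Halg') as [fs [H1 H2]];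
        [intros k; apply Hind' | apply HT with fs; auto].
    + apply beta_dec_f with (B := ix_B S) (d := d'); auto; intros k; apply Hclopen.
  - exists (metric_open d'); split.
    + destruct (dec_g_limit rk v (ix_B S) (ix_C S) lev Hlev _ Halg') as [fs [H1 H2]];
        [intros k; apply Hind' | intros k j; apply Hind' | apply HT with fs; auto].
    + apply beta_dec_g with (d := d'); auto.
      * intros k; apply Hclopen.
      * intros k j; apply Hclopen.
      * intros k; exists (h (ix_len k)); split.
        -- intros j; apply Hen.
        -- apply HLlim, Hh2.
  - rewrite (dec_fg rk v (ix_B S) (ix_C S) lev Hlev).
    intros [tau' [[HP [_ [Hsub _]]] Hbeta]].
    destruct (Hbeta 1) as [a [Ha1 Ha2]]; [lra|].
    destruct (decide_complement d tau Hd Htau xi Hxi e He1 He2 h en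
      (fun n => proj2 (Hen n)) tau' (ix_decided en S) HP Hsub) as [Q [HQ1 HQ2]].
    { intros x Hx; apply (Ha2 x); apply (Dalpha_anti _ _ _ _ (OL h)); auto.
      apply ole_trans with L; auto. }
    destruct (Hdiag Q HQ1) as [x Hx]; specialize (HQ2 x).
    (* Whether x is decided depends only on the truth values at x, so agreement of S and Q at this
       one point makes x belong to A exactly when it does not. *)
    assert (E : (fun i => S i x) = (fun i => Q i x)) by (apply set_ext; exact Hx).
    assert (E' : ix_decided en S x = ix_decided en Q x)
      by exact (f_equal (fun s : nat -> Prop => decide rk v
        (fun k => s (Cantor.to_nat (k, 0%nat)))
        (fun k j => s (Cantor.to_nat (k, Datatypes.S j)))) E).
    rewrite E' in HQ2; tauto.
Qed.
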